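(* Let $p=p(n)$ be a sequence of probability values and let $\Gamma\in G(n,p)$. Suppose that (i) for some sequence $\omega(n)\to\infty$, $p>\frac{\log(n)+\log(\log(n))+\omega(n)}{n}$, and (ii) either $n(1-p)\to 0$ or $n(1-p)\to\infty$. Then a.a.s. $\Gamma$ has no star-cut-vertices. Further, if only hypothesis (i) holds, then a.a.s. for every star-cut-vertex $a$ of $\Gamma$, at most one connected component of the full subgraph $\Gamma\setminus\mathrm{st}(a)$ has more than one vertex.
   Context: $G(n,p)$ is the Erdős–Rényi random graph on $n$ vertices, each edge present independently with probability $p=p(n)$; a.a.s. means with probability tending to $1$ as $n\to\infty$; $\log$ is the natural logarithm. For a vertex $a$, $\mathrm{st}(a)$ is $a$ together with all vertices adjacent to $a$. A vertex $a$ is a star-cut-vertex of $\Gamma$ if the full (induced) subgraph on $V\setminus\mathrm{st}(a)$ is disconnected. *)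

(* Defs.v *)
From HB Require Import structures.
From mathcomp Require Import all_boot all_order all_algebra.
From mathcomp Require Import all_classical all_reals all_analysis.
Set Implicit Arguments. Unset Strict Implicit. Unset Printing Implicit Defensive.
Import Order.TTheory GRing.Theory Num.Theory.
Import numFieldNormedType.Exports.
Local Open Scope ring_scope.

Definition pairs (n : nat) : {set {set 'I_n}} := [set e : {set 'I_n} | #|e| == 2%N].

Definition is_graph (n : nat) (E : {set {set 'I_n}}) : bool := E \subset pairs n.

Definition adj (n : nat) (E : {set {set 'I_n}}) (x y : 'I_n) : bool :=
  (x != y) && ([set x; y] \in E).

Definition star (n : nat) (E : {set {set 'I_n}}) (a : 'I_n) : {set 'I_n} :=
  a |: [set y | adj E a y].

Definition adj_in (n : nat) (E : {set {set 'I_n}}) (S : {set 'I_n}) : rel 'I_n :=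
  fun x y => [&& x \in S, y \in S & adj E x y].

Definition comp_in (n : nat) (E : {set {set 'I_n}}) (S : {set 'I_n}) (x : 'I_n)
  : {set 'I_n} := [set y in S | connect (adj_in E S) x y].

Definition disconnected_in (n : nat) (E : {set {set 'I_n}}) (S : {set 'I_n}) : Prop :=
  exists x y, [/\ x \in S, y \in S & ~~ connect (adj_in E S) x y].

Definition star_cut_vertex (n : nat) (E : {set {set 'I_n}}) (a : 'I_n) : Prop :=
  disconnected_in E (~: star E a).

Definition Gnp_prob (R : realType) (n : nat) (p : R)
  (P : {set {set 'I_n}} -> Prop) : R :=
  \sum_(E : {set {set 'I_n}} | is_graph E && `[< P E >])
     p ^+ #|E| * (1 - p) ^+ (#|pairs n| - #|E|).

Local Open Scope classical_set_scope.
Definition aas (R : realType) (p : nat -> R)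
  (P : forall n : nat, {set {set 'I_n}} -> Prop) : Prop :=
  (fun n => Gnp_prob (p n) (P n)) @ \oo --> (1 : R).

(* Main.v *)
(** Write [t = n p] and [q = 1 - p].  Everything is a first-moment computation:
    a bad graph contains a small witness [Z] (the vertex [a] together with part
    of the components of the complement of its star) such that every vertex
    outside [Z] is adjacent to [a] or else misses a prescribed part of [Z]; these
    conditions concern disjoint sets of edges, so the probability is a power with
    exponent [n - |Z|].

    - Two components with more than one vertex.  If [p >= 1/32], two vertices in
      each component give the bound [n^5 q^8 (1 - p^2 q)^(n-5)].  If [p <= 1/32],
      put [r = ceil(1/p)].  Either some component has [k < r] vertices and contains
      an edge, with expected number at most
      [n 'C(n, k) k^2 p (p + q^(k+1))^(n-k-1)], about [t (n e^-t)^k], or both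
      components contain [r] vertices.
    - An isolated vertex [x].  All neighbours of [x] are adjacent to [a].  For
      [p <= 1/32], hypothesis (i) is exactly what excludes vertices of degree at
      most [1], and two common neighbours of [x] and [a] cost
      [n^4 p^4 q (1 - p q)^(n-4)].  For [p >= 1/32], a third vertex outside the
      star yields an independent triple and the bound
      [n^3 q^3 (1 - p q)^(n-3)], which vanishes when [n q] tends to [0] or to
      infinity. *)
Require Import Defs.
From HB Require Import structures.
From mathcomp Require Import all_boot all_order all_algebra.
From mathcomp Require Import all_classical all_reals all_analysis.
From mathcomp Require Import zify ring lra.
Set Implicit Arguments. Unset Strict Implicit. Unset Printing Implicit Defensive.
Import Order.TTheory GRing.Theory Num.Theory.
Import numFieldNormedType.Exports.
Local Open Scope ring_scope.

(** * First moment bounds in G(n, p) *)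

Section RandomGraph.
Variables (R : realType) (n : nat) (p : R).
Hypothesis p01 : 0 <= p <= 1.
Implicit Types (E : {set {set 'I_n}}) (I O : {set 'I_n * 'I_n}).
Implicit Types P Q : {set {set 'I_n}} -> Prop.

Let p_ge0 : 0 <= p. Proof. by case/andP: p01. Qed.
Let q_ge0 : 0 <= 1 - p. Proof. by rewrite subr_ge0; case/andP: p01. Qed.

Lemma Gnp_weight_ge0 E : 0 <= p ^+ #|E| * (1 - p) ^+ (#|pairs n| - #|E|).
Proof. by rewrite mulr_ge0 ?exprn_ge0. Qed.

Lemma Gnp_prob_ge0 P : 0 <= Gnp_prob p P.
Proof. by apply: sumr_ge0 => E _; exact: Gnp_weight_ge0. Qed.

(** Union bound over witnesses: once the two sums are swapped, the weight of each graph with [P]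
    occurs at least once on the right. *)
Lemma Gnp_prob_le_sum (T : finType) (A : pred T)
    (Q : T -> {set {set 'I_n}} -> Prop) P :
    (forall E, is_graph E -> P E -> exists2 i, A i & Q i E) ->
  Gnp_prob p P <= \sum_(i | A i) Gnp_prob p (Q i).
Proof.
move=> PQ; rewrite /Gnp_prob.
rewrite (exchange_big_dep (fun E => is_graph E))/=; last by move=> i E _ /andP[].
rewrite big_mkcondr/=.
apply: ler_sum => E Egr; case: asboolP => [PE|_]; last first.
  by apply: sumr_ge0 => i _; exact: Gnp_weight_ge0.
have [i Ai QiE] := PQ E Egr PE.
rewrite (bigD1 i)/=; last by rewrite Ai Egr; apply/asboolP.
by rewrite lerDl sumr_ge0// => j _; exact: Gnp_weight_ge0.
Qed.

Lemma Gnp_prob_mono P Q : (forall E, is_graph E -> P E -> Q E) ->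
  Gnp_prob p P <= Gnp_prob p Q.
Proof.
move=> PQ; rewrite (le_trans (@Gnp_prob_le_sum unit predT (fun=> Q) P _))//.
  by move=> E Egr PE; exists tt => //; exact: PQ.
by rewrite (bigD1 tt)//= big1 ?addr0// => -[].
Qed.

Lemma Gnp_prob_or P Q :
  Gnp_prob p (fun E => P E \/ Q E) <= Gnp_prob p P + Gnp_prob p Q.
Proof.
rewrite (le_trans (@Gnp_prob_le_sum bool predT (fun b => if b then P else Q) _ _))//.
  by move=> E _ [?|?]; [exists true|exists false].
by rewrite big_bool.
Qed.

Definition constrained I O E : bool :=
  [forall e in I, adj E e.1 e.2] && [forall e in O, ~~ adj E e.1 e.2].

Lemma constrainedP I O E : reflect ((forall x y, (x, y) \in I -> adj E x y) /\
    (forall x y, (x, y) \in O -> ~~ adj E x y)) (constrained I O E).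
Proof.
apply: (iffP andP) => -[h1 h2]; split.
- by move=> x y xy; move/forall_inP : h1 => /(_ _ xy).
- by move=> x y xy; move/forall_inP : h2 => /(_ _ xy).
- by apply/forall_inP => -[x y]; exact: h1.
- by apply/forall_inP => -[x y]; exact: h2.
Qed.

(* Each unordered pair is named by at most one ordered pair of [D]. *)
Definition oriented (D : {set 'I_n * 'I_n}) :=
  forall x y, (x, y) \in D -> (x != y) /\ (y, x) \notin D.

Let upair (e : 'I_n * 'I_n) : {set 'I_n} := [set e.1; e.2].

Lemma upair_inj D : oriented D -> {in D &, injective upair}.
Proof.
move=> oD [x y] [z w] xyD zwD; rewrite /upair/= => exy.
have [xy yxD] := oD _ _ xyD; have [zw wzD] := oD _ _ zwD.
have /orP[/eqP xz|/eqP xw] : (x == z) || (x == w).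
  by have := set21 x y; rewrite exy !inE.
- have : y \in [set z; w] by rewrite -exy set22.
  rewrite !inE -xz eq_sym (negbTE xy)/= => /eqP ->; by rewrite xz.
- have : y \in [set z; w] by rewrite -exy set22.
  rewrite !inE -xw [y == x]eq_sym (negbTE xy) orbF => /eqP yz.
  by move: zwD; rewrite -yz -xw (negbTE yxD).
Qed.

(** Independence of the edges appears here as distributivity: the sum of the weights over all [E]
    expands a product over [e] of a factor for [e] present plus a factor for [e] absent. *)
Lemma Gnp_prob_constrained I O : oriented (I :|: O) -> [disjoint I & O] ->
  Gnp_prob p (constrained I O) = p ^+ #|I| * (1 - p) ^+ #|O|.
Proof.
move=> oIO dIO.
have inj := upair_inj oIO.
have injI : {in I &, injective upair}.
  by move=> e f eI fI; apply: inj; rewrite inE ?eI ?fI.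
have injO : {in O &, injective upair}.
  by move=> e f eI fI; apply: inj; rewrite inE ?eI ?fI orbT.
have pairsIO e : e \in I :|: O -> upair e \in pairs n.
  by case: e => x y /oIO[xy _]; rewrite inE cards2 xy.
pose I' := upair @: I; pose O' := upair @: O.
have I'P e : e \in I' -> e \in pairs n.
  by case/imsetP => f fI ->; rewrite pairsIO// inE fI.
have O'P e : e \in O' -> e \in pairs n.
  by case/imsetP => f fI ->; rewrite pairsIO// inE fI orbT.
have IO' e : e \in I' -> e \notin O'.
  case/imsetP => f fI ->; apply/imsetP => -[g gO] /inj fg.
  have /fg fg' : f \in I :|: O by rewrite inE fI.
  by move/disjointFr : dIO => /(_ f fI); rewrite fg' ?gO// inE gO orbT.
have cE E : is_graph E ->
    constrained I O E = (I' \subset E) && [disjoint O' & E].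
  move=> Egr; apply/constrainedP/andP => [[h1 h2]|[/fintype.subsetP h1 h2]].
    split; first by apply/fintype.subsetP => e /imsetP[[x y] /h1/andP[_ ?] ->].
    apply/pred0P => e /=; apply/negP => /andP[/imsetP[[x y] xy ->] xyE].
    have [] := oIO x y; first by rewrite inE xy orbT.
    by have := h2 _ _ xy; rewrite negb_and negbK => /orP[/eqP->|/negP//]; rewrite eqxx.
  split => x y xy.
    have [|xny _] := oIO x y; first by rewrite inE xy.
    by rewrite /adj xny/= h1//; apply/imsetP; exists (x, y).
  rewrite negb_and; apply/orP; right.
  by have /(disjointFr h2)/= -> : upair (x, y) \in O' by apply/imsetP; exists (x, y).
(* [F e] is the factor for [e] present and [G e] the one for [e] absent. Zeros are placed so that
   every excluded [E] contributes 0; [F e + G e] is [p] on [I'], [1 - p] on [O'] and 1 elsewhere. *)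
pose F e : R := if e \notin pairs n then 0 else if e \in O' then 0 else p.
pose G e : R := if e \notin pairs n then 1 else if e \in I' then 0 else 1 - p.
transitivity (\sum_(E : {set {set 'I_n}}) \prod_e (if e \in E then F e else G e)).
  rewrite /Gnp_prob big_mkcond; apply: eq_bigr => E _.
  have [Egr|nEgr] /= := boolP (is_graph E); last first.
    have /fintype.subsetPn[e eE ep] := nEgr.
    by rewrite (bigD1 e)//= eE /F ep mul0r.
  have Egs : E \subset pairs n := Egr.
  rewrite cE// asboolb; have [I'E|] /= := boolP (I' \subset E); last first.
    move=> /fintype.subsetPn[e eI eE]; rewrite (bigD1 e)//= (negbTE eE) /G I'P//= eI.
    by rewrite mul0r.
  have [dOE|] := boolP [disjoint O' & E]; last first.
    move=> /pred0Pn[e/= /andP[eO eE]]; rewrite (bigD1 e)//= eE /F O'P//= eO.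
    by rewrite mul0r.
  rewrite (bigID (mem E))/=; congr (_ * _).
    rewrite -prodr_const; apply: eq_bigr => e eE; rewrite /F eE.
    have := fintype.subsetP Egs _ eE; have := disjointFl dOE eE.
    by move=> -> ->.
  rewrite (bigID (mem (pairs n)))/= [X in _ * X]big1 ?mulr1; last first.
    by move=> e /andP[eE ep]; rewrite (negbTE eE) /G ep.
  have -> : (#|pairs n| - #|E| = #|pairs n :\: E|)%N.
    by rewrite cardsD (finset.setIidPr Egs).
  rewrite -prodr_const.
  apply: eq_big => [e|e]; first by rewrite finset.in_setD.
  rewrite finset.in_setD => /andP[eE ep]; rewrite (negbTE eE) /G ep/=.
  by case: ifP => // /(fintype.subsetP I'E); rewrite (negbTE eE).
rewrite -bigA_distr -(card_in_imset injI) -(card_in_imset injO) -/I' -/O'.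
rewrite (bigID (mem I'))/= -prodr_const; congr (_ * _).
  by apply: eq_bigr => e eI; rewrite /F /G I'P//= eI addr0 (negbTE (IO' _ eI)).
rewrite (bigID (mem O'))/= [X in _ * X]big1 ?mulr1; last first.
  move=> e /andP[eI eO]; rewrite /F /G (negbTE eI) (negbTE eO).
  by case: ifP; rewrite ?add0r// subrKC.
rewrite -prodr_const; apply: eq_big => [e|e].
  by rewrite andb_idl//; apply: contraL; exact: IO'.
by move=> /andP[eI eO]; rewrite /F /G O'P//= (negbTE eI) eO add0r.
Qed.

Lemma Gnp_probT : Gnp_prob p (fun _ : {set {set 'I_n}} => True) = 1.
Proof.
have := @Gnp_prob_constrained finset.set0 finset.set0.
rewrite !cards0 !expr0 mulr1 => <-.
- congr Gnp_prob; apply/funext => E; apply/propext; split => // _.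
  by apply/constrainedP; split => x y; rewrite inE.
- by move=> x y; rewrite !inE.
- by apply/pred0P => e; rewrite !inE.
Qed.

Lemma Gnp_probC P : Gnp_prob p P = 1 - Gnp_prob p (fun E => ~ P E).
Proof.
suff -> : 1 = Gnp_prob p P + Gnp_prob p (fun E => ~ P E) by rewrite addrK.
rewrite -Gnp_probT /Gnp_prob.
rewrite (eq_bigl (@is_graph n)) => [|E]; last by rewrite asboolT// andbT.
rewrite (bigID (fun E => `[< P E >]))/=; congr (_ + _).
by apply: eq_bigl => E; rewrite asbool_neg.
Qed.

End RandomGraph.

(** * Witnesses with labelled outside vertices *)

Section LabelledStars.
Variables (R : realType) (n : nat) (p : R).
Hypothesis p01 : 0 <= p <= 1.

(** A label is one of the possible reasons why an outside vertex [w] does not spoil the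
    configuration. Labels may overlap; only the sum of their probabilities matters. *)
Definition label_ok (L : finType) (IN OUT : L -> {set 'I_n}) E (w : 'I_n) l :=
  [forall z in IN l, adj E z w] && [forall z in OUT l, ~~ adj E z w].

Definition labelled (L : finType) (IN OUT : L -> {set 'I_n}) (Z : {set 'I_n}) E :=
  forall w, w \notin Z -> exists l, label_ok IN OUT E w l.

(* Union bound over the assignments [f] of a label to each vertex outside [Z]:
   for a given [f] the event is a cylinder. *)
Lemma Gnp_prob_labelled (L : finType) (l0 : L) (IN OUT : L -> {set 'I_n})
    (Z : {set 'I_n}) (I O : {set 'I_n * 'I_n}) :
    (forall l, IN l \subset Z) -> (forall l, OUT l \subset Z) ->
    (forall l, [disjoint IN l & OUT l]) ->
    I :|: O \subset finset.setX Z Z -> oriented (I :|: O) -> [disjoint I & O] ->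
  Gnp_prob p (fun E => constrained I O E /\ labelled IN OUT Z E) <=
  p ^+ #|I| * (1 - p) ^+ #|O| *
  (\sum_l p ^+ #|IN l| * (1 - p) ^+ #|OUT l|) ^+ (n - #|Z|).
Proof.
move=> INZ OUTZ dL IOZ oIO dIO.
have p_ge0 : 0 <= p by case/andP: p01.
have q_ge0 : 0 <= 1 - p by rewrite subr_ge0; case/andP: p01.
(* The pairs prescribed by the labelling [f], always oriented from [Z] to the outside vertex, so
   that they never clash with pairs inside [Z]. *)
pose spokes (A : L -> {set 'I_n}) (f : {ffun 'I_n -> L}) :=
  [set e : 'I_n * 'I_n | (e.2 \notin Z) && (e.1 \in A (f e.2))].
have card_spokes A f : #|spokes A f| = (\sum_(w | w \notin Z) #|A (f w)|)%N.
  rewrite -sum1_card (reindex_onto (fun e => (e.2, e.1))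
    (fun e => (e.2, e.1)))/=; last by case.
  rewrite -(eq_bigr _ (fun w _ => sum1_card _)) pair_big_dep/=.
  by apply: eq_bigl => -[w z]; rewrite !inE/= eqxx andbT.
have in_Z e : e \in I :|: O -> (e.1 \in Z) && (e.2 \in Z).
  by move/(fintype.subsetP IOZ); rewrite inE.
have spoke_out A f e : e \in spokes A f -> e.2 \notin Z.
  by rewrite inE => /andP[].
have spokeL A f (x y : 'I_n) : (x, y) \in spokes A f -> x \in A (f y).
  by rewrite inE => /andP[].
(* Labellings are fixed to [l0] on [Z]. Each choice of outside labels is thus counted once, and the
   sum over [fs] is the expansion of a power with exponent [n - #|Z|]. *)
pose fs := pffun_on l0 [predC Z] (predT : pred L).
apply: (le_trans (@Gnp_prob_le_sum _ _ _ p01 _ (mem fs)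
  (fun f => constrained (I :|: spokes IN f) (O :|: spokes OUT f)) _ _)).
  move=> E _ [/constrainedP[hI hO] lab].
  exists [ffun w => if w \in Z then l0 else odflt l0 [pick l | label_ok IN OUT E w l]].
    apply/pffun_onP; split => //.
    apply/supportP => w; rewrite inE negbK ffunE => ->//.
  have ok w : w \notin Z ->
      label_ok IN OUT E w (odflt l0 [pick l | label_ok IN OUT E w l]).
    by move=> /lab[l okl]; case: pickP => // /(_ l); rewrite okl.
  apply/constrainedP; split => x y; rewrite inE => /orP[|]; [exact: hI| |exact: hO|].
    rewrite inE/= ffunE => /andP[yZ]; rewrite (negbTE yZ) => xl.
    by have /andP[/forall_inP/(_ _ xl)] := ok _ yZ.
  rewrite inE/= ffunE => /andP[yZ]; rewrite (negbTE yZ) => xl.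
  by have /andP[_ /forall_inP/(_ _ xl)] := ok _ yZ.
have -> : (n - #|Z|)%N = #|[predC Z]|
  by have := cardC Z; rewrite card_ord => h; lia.
rewrite -[X in _ <= _ * X]prodr_const (big_distr_big l0)/= mulr_sumr.
apply: ler_sum => f _.
have dsp : [disjoint spokes IN f & spokes OUT f].
  apply/pred0P => -[x y]/=; apply/negP => /andP[/spokeL xi /spokeL xo].
  by rewrite (disjointFr (dL _) xi) in xo.
have dIs (B : {set 'I_n * 'I_n}) A : B \subset I :|: O -> [disjoint B & spokes A f].
  move=> BIO; apply/pred0P => e/=; apply/negP.
  move=> /andP[/(fintype.subsetP BIO)/in_Z/andP[_ eZ]].
  by move/spoke_out; rewrite eZ.
rewrite Gnp_prob_constrained//; last 2 first.
- move=> x y; rewrite finset.setUACA finset.in_setU => /orP[xy|].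
    have [xny yx] := oIO _ _ xy; split => //.
    rewrite finset.in_setU negb_or yx/=; have /andP[/= xZ _] := in_Z _ xy.
    by apply/negP; rewrite finset.in_setU => /orP[|] /spoke_out/=; rewrite xZ.
  move=> xys.
  have [xZ yZ] : x \in Z /\ y \notin Z.
    move: xys; rewrite finset.in_setU => /orP[|] xy;
      have /= := spoke_out _ _ _ xy => yZ; split => //.
      by apply: (fintype.subsetP (INZ (f y))); exact: spokeL xy.
    by apply: (fintype.subsetP (OUTZ (f y))); exact: spokeL xy.
  split; first by apply: contraNneq yZ => <-.
  apply/negP; rewrite finset.in_setU => /orP[/in_Z/=|].
    by rewrite (negbTE yZ).
  by rewrite finset.in_setU => /orP[|] /spoke_out/=; rewrite xZ.
- apply/pred0P => e/=; apply/negP => /andP[].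
  rewrite !finset.in_setU => /orP[eI|eI] /orP[eO|eO].
  + by rewrite (disjointFr dIO eI) in eO.
  + by have /in_Z/andP[_] : e \in I :|: O;
      [rewrite inE eI | exact/negP/(spoke_out _ _ _ eO)].
  + by have /in_Z/andP[_] : e \in I :|: O;
      [rewrite inE eO orbT | exact/negP/(spoke_out _ _ _ eI)].
  + by rewrite (disjointFr dsp eI) in eO.
have cU (A B : {set 'I_n * 'I_n}) : [disjoint A & B] -> #|A :|: B| = (#|A| + #|B|)%N.
  by move=> dAB; rewrite cardsU disjoint_setI0// cards0 subn0.
rewrite !cU ?dIs ?finset.subsetUl ?finset.subsetUr//.
rewrite !exprD !card_spokes big_split/= !expr_sum.
by rewrite le_eqVlt; apply/orP; left; apply/eqP; rewrite mulrACA.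
Qed.

End LabelledStars.

(** * Bad configurations and their expected numbers *)

Section Configurations.
Variables (R : realType) (n : nat) (p : R).
Hypothesis p01 : 0 <= p <= 1.
Implicit Types (E : {set {set 'I_n}}) (a x y w : 'I_n) (K X Y W : {set 'I_n}).

Let p_ge0 : 0 <= p. Proof. by case/andP: p01. Qed.
Let q_ge0 : 0 <= 1 - p. Proof. by rewrite subr_ge0; case/andP: p01. Qed.

Lemma adjC E x y : adj E x y = adj E y x.
Proof. by rewrite /adj eq_sym finset.setUC. Qed.

(** Template for all the first-moment bounds below: a union bound over the witnesses [t], whose
    sizes do not depend on [t], so that the sum is [N] times a single term. *)
Lemma Gnp_prob_witness (T L : finType) (l0 : L) (A : {pred T})
    (IN OUT : T -> L -> {set 'I_n}) (Z : T -> {set 'I_n})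
    (I O : T -> {set 'I_n * 'I_n}) (N z i o : nat) (B : R) P :
    (forall E, is_graph E -> P E -> exists2 t, t \in A &
      constrained (I t) (O t) E /\ labelled (IN t) (OUT t) (Z t) E) ->
    (forall t, t \in A -> [/\ #|Z t| = z, #|I t| = i & #|O t| = o]) ->
    (forall t, t \in A -> [/\ I t :|: O t \subset finset.setX (Z t) (Z t),
       oriented (I t :|: O t) & [disjoint I t & O t]]) ->
    (forall t l, t \in A ->
       [/\ IN t l \subset Z t, OUT t l \subset Z t & [disjoint IN t l & OUT t l]]) ->
    (forall t, t \in A ->
       \sum_l p ^+ #|IN t l| * (1 - p) ^+ #|OUT t l| <= B) ->
    (#|A| <= N)%N -> 0 <= B ->
  Gnp_prob p P <= N%:R * (p ^+ i * (1 - p) ^+ o * B ^+ (n - z)).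
Proof.
move=> HP Hc Ho Hl HB HN B_ge0.
apply: le_trans (@Gnp_prob_le_sum _ _ _ p01 _ (mem A) _ _ HP) _.
have s_ge0 t : 0 <= \sum_l p ^+ #|IN t l| * (1 - p) ^+ #|OUT t l|.
  by apply: sumr_ge0 => l _; rewrite mulr_ge0 ?exprn_ge0.
apply: (@le_trans _ _ (\sum_(t in A) (p ^+ i * (1 - p) ^+ o * B ^+ (n - z)))).
  apply: ler_sum => t tA.
  have [cZ cI cO] := Hc _ tA; have [sIO oIO dIO] := Ho _ tA.
  apply: le_trans (Gnp_prob_labelled p01 l0 _ _ _ sIO oIO dIO) _.
  - by move=> l; case: (Hl t l tA).
  - by move=> l; case: (Hl t l tA).
  - by move=> l; case: (Hl t l tA).
  rewrite cZ cI cO ler_wpM2l ?mulr_ge0 ?exprn_ge0//.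
  by rewrite lerXn2r ?nnegrE// ?HB//.
rewrite sumr_const.
rewrite -[leLHS]mulr_natl; apply: ler_wpM2r; last by rewrite ler_nat.
by rewrite !mulr_ge0 ?exprn_ge0.
Qed.

(** [a] is the centre of the star, [x] a vertex isolated outside it, [y] another vertex outside it.
    Recording [y] gives the prefactor [n^3 q^3], a function of [n q] alone, where [q = 1 - p]. *)
Definition independent_triple E : Prop := exists a x y,
  [/\ [/\ a != x, a != y & x != y] &
   [/\ ~~ adj E a x, ~~ adj E a y, ~~ adj E x y &
      forall w, w != a -> w != x -> w != y -> adj E a w || ~~ adj E x w]].

Definition two_common_neighbours E : Prop := exists a x W,
  [/\ [/\ a != x, a \notin W, x \notin W & #|W| = 2%N] &
   [/\ ~~ adj E a x, forall w, w \in W -> adj E a w && adj E x w &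
      forall w, w != a -> w != x -> w \notin W -> adj E a w || ~~ adj E x w]].

Definition has_degree (d : nat) E : Prop := exists x W,
  [/\ x \notin W, #|W| = d, forall w, w \in W -> adj E x w &
      forall w, w != x -> w \notin W -> ~~ adj E x w].

(** [K] stands for a whole component outside the star of [a]. The edge [x y] inside it contributes a
    factor [p], which turns the factor [n] for the choice of [a] into [n p]. *)
Definition small_side (k : nat) E : Prop := exists a K x y,
  [/\ [/\ a \notin K, #|K| = k, x \in K, y \in K & x != y] &
   [/\ adj E x y, forall z, z \in K -> ~~ adj E a z &
      forall w, w != a -> w \notin K ->
        adj E a w \/ forall z, z \in K -> ~~ adj E z w]].

(** [X] and [Y] are subsets of two components, cut down to size exactly [r]. A vertex outside the
    star lies in at most one of the components, hence misses [X] or [Y] entirely. *)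
Definition two_sides (r : nat) E : Prop := exists a X Y,
  [/\ [/\ a \notin X, a \notin Y, [disjoint X & Y], #|X| = r & #|Y| = r] &
   [/\ forall z, z \in X -> ~~ adj E a z, forall z, z \in Y -> ~~ adj E a z,
      forall x y, x \in X -> y \in Y -> ~~ adj E x y &
      forall w, w != a -> w \notin X -> w \notin Y ->
        [\/ adj E a w, forall z, z \in X -> ~~ adj E z w |
             forall z, z \in Y -> ~~ adj E z w]]].

(** An outside vertex is joined to [a], or misses both [a] and [x]: with [q = 1 - p] the two labels
    add up to [p + q^2 = 1 - p q]. *)
Lemma Gnp_independent_triple : Gnp_prob p independent_triple <=
  (n ^ 3)%:R * ((1 - p) ^+ 3 * (1 - p * (1 - p)) ^+ (n - 3)).
Proof.
pose A := [pred t : 'I_n * 'I_n * 'I_n |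
  [&& t.1.1 != t.1.2, t.1.1 != t.2 & t.1.2 != t.2]].
pose IN (t : 'I_n * 'I_n * 'I_n) (b : bool) : {set 'I_n} :=
  if b then [set t.1.1] else finset.set0.
pose OUT (t : 'I_n * 'I_n * 'I_n) (b : bool) : {set 'I_n} :=
  if b then finset.set0 else [set t.1.1; t.1.2].
pose Z (t : 'I_n * 'I_n * 'I_n) := [set t.1.1; t.1.2; t.2].
pose O (t : 'I_n * 'I_n * 'I_n) := [set (t.1.1, t.1.2); (t.1.1, t.2); (t.1.2, t.2)].
rewrite -[(1 - p) ^+ 3]mul1r -[X in X * (1 - p) ^+ 3](expr0 p).
apply: (@Gnp_prob_witness _ _ true A IN OUT Z (fun=> finset.set0) O).
- move=> E _ [a [x [y [[ax ay xy] [nax nay nxy h]]]]].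
  exists (a, x, y); first by rewrite inE /= ax ay xy.
  split.
    apply/constrainedP; split => u v; rewrite !inE// => /orP[/orP[]|];
      by rewrite xpair_eqE => /andP[/eqP -> /eqP ->].
  move=> w; rewrite !inE !negb_or => /andP[/andP[wa wx] wy].
  have /orP[aw|nxw] := h w wa wx wy.
    exists true; apply/andP; split; apply/forall_inP => z; rewrite inE//.
    by move=> /eqP ->.
  have [aw|naw] := boolP (adj E a w).
    exists true; apply/andP; split; apply/forall_inP => z; rewrite inE//.
    by move=> /eqP ->.
  exists false; apply/andP; split; apply/forall_inP => z; rewrite !inE//.
  by move=> /orP[] /eqP ->.
- move=> [[a x] y]; rewrite inE /= => /and3P[ax ay xy]; split.
  + by rewrite /Z/= finset.setUC cardsU1 cards2 !inE negb_or ax eq_sym ay eq_sym xy.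
  + by rewrite cards0.
  + rewrite /O /= finset.setUC cardsU1 cards2 !inE !xpair_eqE !negb_or !negb_and.
    by rewrite [y == x]eq_sym xy [x == a]eq_sym ax !orbT.
- move=> [[a x] y]; rewrite inE /= => /and3P[ax ay xy].
  rewrite finset.set0U; split.
  + apply/fintype.subsetP => -[u v]; rewrite !inE/= => /orP[/orP[]|];
      rewrite xpair_eqE => /andP[/eqP -> /eqP ->]; by rewrite !eqxx ?orbT.
  + move=> u v; rewrite !inE/= => /orP[/orP[]|];
      rewrite xpair_eqE => /andP[/eqP -> /eqP ->];
      rewrite !xpair_eqE ?ax ?ay ?xy ?[x == a]eq_sym ?[y == a]eq_sym ?[y == x]eq_sym;
      by rewrite ?(negbTE ax) ?(negbTE ay) ?(negbTE xy) ?andbF.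
  + by apply/pred0P => e; rewrite /= inE.
- move=> t [] _; split; rewrite /IN /OUT /Z ?finset.sub0set//.
  + by apply/fintype.subsetP => z; rewrite !inE => ->.
  + by apply/pred0P => z; rewrite /= !inE andbF.
  + by apply/fintype.subsetP => z; rewrite !inE => ->.
  + by apply/pred0P => z; rewrite /= !inE.
- move=> [[a x] y]; rewrite inE /= => /and3P[ax ay xy].
  rewrite big_bool /IN /OUT /= !cards0 cards1 cards2 ax/= !expr0 expr1; lra.
- rewrite (leq_trans (max_card _))// !card_prod card_ord; lia.
- by nra.
Qed.

Lemma card_pred_draws (T : finType) (d : nat) :
  #|[pred t : T * {set 'I_n} | #|t.2| == d]| = (#|T| * 'C(n, d))%N.
Proof.
rewrite -{1}[in RHS](cardsT T) -[in 'C(n, d)](card_ord n) -card_draws -cardsX.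
by apply: eq_card => -[t W]; rewrite !inE.
Qed.

(** The labels are those of the independent triple. Inside the witness there are four edges between
    [{a, x}] and [W], and the non-edge [a x]. *)
Lemma Gnp_two_common_neighbours : Gnp_prob p two_common_neighbours <=
  (n * n * 'C(n, 2))%:R * (p ^+ 4 * (1 - p) ^+ 1 * (1 - p * (1 - p)) ^+ (n - 4)).
Proof.
pose A := [pred t : 'I_n * 'I_n * {set 'I_n} | [&& t.1.1 != t.1.2,
  t.1.1 \notin t.2, t.1.2 \notin t.2 & #|t.2| == 2%N]].
pose IN (t : 'I_n * 'I_n * {set 'I_n}) (b : bool) : {set 'I_n} :=
  if b then [set t.1.1] else finset.set0.
pose OUT (t : 'I_n * 'I_n * {set 'I_n}) (b : bool) : {set 'I_n} :=
  if b then finset.set0 else [set t.1.1; t.1.2].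
pose Z (t : 'I_n * 'I_n * {set 'I_n}) := [set t.1.1; t.1.2] :|: t.2.
pose I (t : 'I_n * 'I_n * {set 'I_n}) := finset.setX [set t.1.1; t.1.2] t.2.
pose O (t : 'I_n * 'I_n * {set 'I_n}) := [set (t.1.1, t.1.2)].
apply: (@Gnp_prob_witness _ _ true A IN OUT Z I O).
- move=> E _ [a [x [W [[ax aW xW cW] [nax hW h]]]]].
  exists (a, x, W); first by rewrite inE /= ax aW xW cW.
  split.
    apply/constrainedP; split => u v; rewrite !inE/=.
      by move=> /andP[/orP[] /eqP -> /hW/andP[]].
    by rewrite xpair_eqE => /andP[/eqP -> /eqP ->].
  move=> w; rewrite !inE !negb_or => /andP[/andP[wa wx] wW].
  have [aw|naw] := boolP (adj E a w).
    exists true; apply/andP; split; apply/forall_inP => z; rewrite inE//.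
    by move=> /eqP ->.
  have := h w wa wx wW; rewrite (negbTE naw)/= => nxw.
  exists false; apply/andP; split; apply/forall_inP => z; rewrite !inE//.
  by move=> /orP[] /eqP ->.
- move=> [[a x] W]; rewrite inE /= => /and4P[ax aW xW /eqP cW]; split.
  + rewrite cardsU cards2 ax cW (_ : _ :&: _ = finset.set0) ?cards0//.
    apply/eqP; rewrite finset.setI_eq0; apply/pred0P => z /=; rewrite !inE.
    by apply/negP => /andP[/orP[] /eqP ->]; exact/negP.
  + by rewrite cardsX cards2 ax cW.
  + by rewrite cards1.
- move=> [[a x] W]; rewrite inE /= => /and4P[ax aW xW /eqP cW].
  split.
  + apply/fintype.subsetP => -[u v]; rewrite !inE/= => /orP[/andP[-> ->]|].
      by rewrite orbT.
    by rewrite xpair_eqE => /andP[/eqP -> /eqP ->]; rewrite !eqxx ?orbT.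
  + have ne z : z \in W -> (z == a = false) * (z == x = false).
      by move=> zW; split; apply/negP => /eqP zz; move: aW xW; rewrite -zz zW.
    move=> u v; rewrite !inE/= => /orP[/andP[/orP[]/eqP -> vW]|].
    * by rewrite xpair_eqE eq_sym !(ne _ vW).
    * by rewrite xpair_eqE eq_sym !(ne _ vW).
    rewrite !xpair_eqE => /andP[/eqP -> /eqP ->].
    by rewrite eqxx (negbTE aW) ax eq_sym (negbTE ax) !andbF.
  + apply/pred0P => -[u v]; rewrite /= !inE /= xpair_eqE.
    by apply/negP => /andP[/andP[_ vW]] /andP[_ /eqP vx]; move: xW; rewrite -vx vW.
- move=> t [] _; split; rewrite /IN /OUT /Z ?finset.sub0set//.
  + by apply/fintype.subsetP => z; rewrite !inE => ->.
  + by apply/pred0P => z; rewrite /= !inE andbF.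
  + by apply/fintype.subsetP => z; rewrite !inE => ->.
  + by apply/pred0P => z; rewrite /= !inE.
- move=> [[a x] W]; rewrite inE /= => /and4P[ax aW xW cW].
  rewrite big_bool /IN /OUT /= !cards0 cards1 cards2 ax/= !expr0 expr1; lra.
- rewrite -[X in (X * X)%N](card_ord n) -card_prod -card_pred_draws.
  by apply/subset_leq_card/fintype.subsetP => t; rewrite !inE => /and4P[].
- by nra.
Qed.

(** Every pair at [x] is prescribed, so [Z] is the full vertex set with one empty label, and the
    label factor has exponent [n - n]. *)
Lemma Gnp_has_degree d : Gnp_prob p (has_degree d) <=
  (n * 'C(n, d))%:R * (p ^+ d * (1 - p) ^+ (n - 1 - d)).
Proof.
pose A := [pred t : 'I_n * {set 'I_n} | (t.1 \notin t.2) && (#|t.2| == d)].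
pose I (t : 'I_n * {set 'I_n}) := finset.setX [set t.1] t.2.
pose O (t : 'I_n * {set 'I_n}) := finset.setX [set t.1] (~: (t.1 |: t.2)).
pose none (t : 'I_n * {set 'I_n}) (u : unit) : {set 'I_n} := finset.set0.
rewrite -[X in _ * X]mulr1 -[X in _ * (_ * X)](expr1n _ (n - n)).
apply: (@Gnp_prob_witness _ _ tt A none none (fun=> finset.setT) I O).
- move=> E _ [x [W [xW cW hW h]]].
  exists (x, W); first by rewrite inE /= xW cW/=.
  split; last by move=> w; rewrite inE.
  apply/constrainedP; split => u v; rewrite !inE/=.
    by move=> /andP[/eqP -> /hW].
  by rewrite negb_or => /andP[/eqP -> /andP[vx vW]]; exact: h.
- move=> [x W]; rewrite inE /= => /andP[xW /eqP cW]; split.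
  + by rewrite cardsT card_ord.
  + by rewrite cardsX cards1 cW mul1n.
  + have := cardsC (x |: W); rewrite cardsX cards1 mul1n cardsU1 xW cW card_ord/=; lia.
- move=> [x W]; rewrite inE /= => /andP[xW _]; split.
  + by apply/fintype.subsetP => -[u v]; rewrite !inE.
  + move=> u v; rewrite !inE/=.
    rewrite -andb_orr => /andP[/eqP -> ].
    case: (eqVneq v x) => [->|vx]; first by rewrite (negbTE xW).
    by [].
  + apply/pred0P => -[u v]; rewrite /= !inE /=.
    by case: (v \in W); rewrite ?orbT ?andbF.
- move=> t l _; split; rewrite /none ?finset.sub0set//.
  by apply/pred0P => z; rewrite /= !inE.
- by move=> t _; rewrite (bigD1 tt)//= big1 => [|[]//]; rewrite cards0 !expr0 mulr1 addr0.
- rewrite -[X in (X * _)%N](card_ord n) -card_pred_draws.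
  by apply/subset_leq_card/fintype.subsetP => t; rewrite !inE => /andP[].
- by [].
Qed.

(** An outside vertex is joined to [a], or misses [a] and all of [K]. The factor [k ^ 2] pays for
    choosing the edge inside [K]. *)
Lemma Gnp_small_side k : Gnp_prob p (small_side k) <=
  (n * 'C(n, k) * k ^ 2)%:R *
  (p ^+ 1 * (1 - p) ^+ k * (p + (1 - p) ^+ k.+1) ^+ (n - k.+1)).
Proof.
pose TT := ('I_n * {set 'I_n} * ('I_n * 'I_n))%type.
pose A := [pred t : TT | [&& t.1.1 \notin t.1.2,
  #|t.1.2| == k, t.2.1 \in t.1.2, t.2.2 \in t.1.2 & t.2.1 != t.2.2]].
pose IN (t : TT) (b : bool) : {set 'I_n} := if b then [set t.1.1] else finset.set0.
pose OUT (t : TT) (b : bool) : {set 'I_n} := if b then finset.set0 else t.1.1 |: t.1.2.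
pose Z (t : TT) := t.1.1 |: t.1.2.
pose I (t : TT) := [set t.2].
pose O (t : TT) := finset.setX [set t.1.1] t.1.2.
apply: (@Gnp_prob_witness _ _ true A IN OUT Z I O).
- move=> E _ [a [K [x [y [[aK cK xK yK xny] [xy naK h]]]]]].
  exists ((a, K), (x, y)); first by rewrite inE /= aK cK xK yK xny eqxx.
  split.
    apply/constrainedP; split => u v; rewrite !inE/=.
      by rewrite xpair_eqE => /andP[/eqP -> /eqP ->].
    by move=> /andP[/eqP -> /naK].
  move=> w; rewrite !inE !negb_or => /andP[wa wK].
  have [aw|naw] := boolP (adj E a w).
    exists true; apply/andP; split; apply/forall_inP => z; rewrite inE//.
    by move=> /eqP ->.
  have [|nKw] := h w wa wK; first by rewrite (negbTE naw).
  exists false; apply/andP; split; apply/forall_inP => z; rewrite !inE//.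
  by move=> /orP[/eqP ->//|/nKw].
- move=> [[a K] [x y]]; rewrite inE /= => /and5P[aK /eqP cK xK yK xny]; split.
  + by rewrite cardsU1 aK cK.
  + by rewrite cards1.
  + by rewrite cardsX cards1 cK mul1n.
- move=> [[a K] [x y]]; rewrite inE /= => /and5P[aK _ xK yK xny].
  have ne z : z \in K -> (z == a = false) * (a == z = false).
    by move=> zW; split; apply/negP => /eqP zz; move: aK; rewrite ?zz ?zW// -zz zW.
  split.
  + apply/fintype.subsetP => -[u v]; rewrite !inE/= => /orP[|/andP[-> ->]].
      by rewrite xpair_eqE => /andP[/eqP -> /eqP ->]; rewrite xK yK !orbT.
    by rewrite orbT.
  + move=> u v; rewrite !inE/= => /orP[|/andP[/eqP -> vK]].
      rewrite !xpair_eqE => /andP[/eqP -> /eqP ->].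
      by rewrite xny !(ne _ yK) [x == y](negbTE xny) andbF.
    rewrite !(ne _ vK)/= orbF; split => //.
    by apply/eqP => -[_ ay]; rewrite ay yK in aK.
  + apply/pred0P => -[u v]; rewrite /= !inE /= xpair_eqE.
    apply/negP => /andP[/andP[/eqP -> /eqP ->]] /andP[/eqP xa _].
    by rewrite -xa xK in aK.
- move=> t [] _; split; rewrite /IN /OUT /Z ?finset.sub0set//.
  + by apply/fintype.subsetP => z; rewrite !inE => ->.
  + by apply/pred0P => z; rewrite /= !inE andbF.
  + by apply/pred0P => z; rewrite /= !inE.
- move=> [[a K] [x y]]; rewrite inE /= => /and5P[aK /eqP cK _ _ _].
  by rewrite big_bool /IN /OUT /= !cards0 cards1 cardsU1 aK cK !expr0 expr1 mulr1 mul1r.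
- apply: (@leq_trans #|[pred t : TT | (#|t.1.2| == k) && (t.2 \in finset.setX t.1.2 t.1.2)]|).
    apply/subset_leq_card/fintype.subsetP => -[[a K] [x y]].
    by rewrite !inE/= => /and5P[_ -> -> ->].
  rewrite -sum1_card -(pair_big_dep (fun s : 'I_n * {set 'I_n} => #|s.2| == k)
     (fun s e => e \in finset.setX s.2 s.2) (fun=> fun=> 1%N))/=.
  rewrite (eq_bigr (fun=> k ^ 2)%N) => [|s /eqP cs]; last first.
    by rewrite sum1_card cardsX cs expnS expn1.
  by rewrite sum_nat_const card_pred_draws card_ord.
- by rewrite addr_ge0// exprn_ge0.
Qed.

End Configurations.

(** * Two sides with [r] vertices each *)

Section TwoSides.
Variables (R : realType) (n : nat) (p : R).
Hypothesis p01 : 0 <= p <= 1.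
Implicit Types (E : {set {set 'I_n}}) (a x y w : 'I_n) (K X Y W : {set 'I_n}).

Let p_ge0 : 0 <= p. Proof. by case/andP: p01. Qed.
Let q_ge0 : 0 <= 1 - p. Proof. by rewrite subr_ge0; case/andP: p01. Qed.

Let TT := ('I_n * {set 'I_n} * {set 'I_n})%type.

Let A (r : nat) := [pred t : TT | [&& t.1.1 \notin t.1.2, t.1.1 \notin t.2,
  [disjoint t.1.2 & t.2], #|t.1.2| == r & #|t.2| == r]].

(** Common part of the two bounds below: [r + r] non-edges at [a] and [r * r] between the sides. The
    choice of labels is left open. *)
Let Gnp_two_sides_labelled (r : nat) (L : finType) (l0 : L)
    (IN OUT : TT -> L -> {set 'I_n}) (B : R) :
    (forall t E w, t \in A r ->
      [\/ adj E t.1.1 w, forall z, z \in t.1.2 -> ~~ adj E z w |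
          forall z, z \in t.2 -> ~~ adj E z w] ->
      exists l, label_ok (IN t) (OUT t) E w l) ->
    (forall t l, t \in A r -> [/\ IN t l \subset t.1.1 |: (t.1.2 :|: t.2),
      OUT t l \subset t.1.1 |: (t.1.2 :|: t.2) & [disjoint IN t l & OUT t l]]) ->
    (forall t, t \in A r ->
       \sum_l p ^+ #|IN t l| * (1 - p) ^+ #|OUT t l| <= B) -> 0 <= B ->
  Gnp_prob p (@two_sides n r) <= (n * 'C(n, r) * 'C(n, r))%:R *
    ((1 - p) ^+ (r + r + r * r) * B ^+ (n - (r + r).+1)).
Proof.
move=> Hlab Hl HB B_ge0.
pose Z (t : TT) := t.1.1 |: (t.1.2 :|: t.2).
pose O (t : TT) := finset.setX [set t.1.1] (t.1.2 :|: t.2) :|: finset.setX t.1.2 t.2.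
rewrite -[(1 - p) ^+ _]mul1r -[X in X * (1 - p) ^+ _](expr0 p).
have dU X Y : [disjoint X & Y] -> #|X :|: Y| = (#|X| + #|Y|)%N.
  by move=> d; rewrite cardsU disjoint_setI0// cards0 subn0.
apply: (@Gnp_prob_witness _ _ _ p01 _ _ l0 (A r) IN OUT Z (fun=> finset.set0) O) => //.
- move=> E _ [a [X [Y [[aX aY dXY cX cY] [naX naY nXY h]]]]].
  have tA : (a, X, Y) \in A r by rewrite inE /= aX aY dXY cX cY eqxx.
  exists (a, X, Y) => //; split.
    apply/constrainedP; split => u v; rewrite !inE//=.
    move=> /orP[/andP[/eqP -> /orP[/naX|/naY]//]|/andP[uX vY]].
    exact: nXY.
  move=> w; rewrite !inE !negb_or => /and3P[wa wX wY].
  exact: (Hlab _ _ _ tA (h w wa wX wY)).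
- move=> [[a X] Y]; rewrite inE /= => /and5P[aX aY dXY /eqP cX /eqP cY]; split.
  + by rewrite cardsU1 inE (negbTE aX) (negbTE aY)/= dU// cX cY.
  + by rewrite cards0.
  + rewrite cardsU !cardsX dU// cards1 cX cY mul1n.
    rewrite (_ : _ :&: _ = finset.set0) ?cards0 ?subn0//.
    apply/finset.setP => -[u v]; rewrite !inE/=; apply/negP.
    by move=> /andP[/andP[/eqP -> _]]; rewrite (negbTE aX).
- move=> [[a X] Y]; rewrite inE /= => /and5P[aX aY dXY _ _]; rewrite finset.set0U.
  split.
  + apply/fintype.subsetP => -[u v]; rewrite !inE/=.
    by move=> /orP[/andP[-> ->]|/andP[-> ->]]; rewrite ?orbT.
  + have neX z : z \in X -> (z == a = false) * (a == z = false) * (z \in Y = false).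
      by move=> zX; rewrite (disjointFr dXY zX); split => //; split;
        apply: contraNF aX => /eqP; [move=> <-|move=> ->].
    have neY z : z \in Y -> (z == a = false) * (a == z = false) * (z \in X = false).
      by move=> zX; rewrite (disjointFl dXY zX); split => //; split;
        apply: contraNF aY => /eqP; [move=> <-|move=> ->].
    move=> u v; rewrite !inE/=.
    move=> /orP[/andP[/eqP -> /orP[vX|vY]]|/andP[uX vY]].
    * by rewrite !(neX _ vX) (negbTE aY) andbF.
    * by rewrite !(neY _ vY).
    * rewrite !(neX _ uX) !(neY _ vY); split => //.
      by apply: contraTneq uX => ->; rewrite !(neY _ vY).
  + by apply/pred0P => e; rewrite /= inE.
- apply: (@leq_trans #|[pred t : TT | (#|t.1.2| == r) && (#|t.2| == r)]|).
    apply/subset_leq_card/fintype.subsetP => -[[a X] Y].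
    by rewrite !inE/= => /and5P[_ _ _ -> ->].
  rewrite -sum1_card -(pair_big (fun s : 'I_n * {set 'I_n} => #|s.2| == r)
     (fun Y => #|Y| == r) (fun=> fun=> 1%N))/=.
  rewrite sum_nat_const card_pred_draws card_ord sum_nat_const muln1 leq_mul2l.
  rewrite -[in 'C(n, r)](card_ord n) -card_draws; apply/orP; right.
  by rewrite eq_leq//; apply: eq_card => Y; rewrite !inE.
Qed.

(** Labels: joined to [a], missing [a] and [X], missing [a] and [Y]. The last two overlap, which is
    affordable once [(1 - p) ^+ r.+1] is well below 1/2. *)
Lemma Gnp_two_sides (r : nat) : Gnp_prob p (@two_sides n r) <=
  (n * 'C(n, r) * 'C(n, r))%:R *
  ((1 - p) ^+ (r + r + r * r) * (p + (1 - p) ^+ r.+1 *+ 2) ^+ (n - (r + r).+1)).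
Proof.
pose IN (t : TT) (l : unit + bool) : {set 'I_n} :=
  if l is inl _ then [set t.1.1] else finset.set0.
pose OUT (t : TT) (l : unit + bool) : {set 'I_n} :=
  if l is inr b then t.1.1 |: (if b then t.1.2 else t.2) else finset.set0.
apply: (@Gnp_two_sides_labelled _ _ (inl tt) IN OUT).
- move=> [[a X] Y] E w _ /= h.
  have [aw|naw] := boolP (adj E a w).
    exists (inl tt); apply/andP; split; apply/forall_inP => z; rewrite inE//.
    by move=> /eqP ->.
  case: h => [|hX|hY]; first by rewrite (negbTE naw).
    exists (inr true); apply/andP; split; apply/forall_inP => z; rewrite !inE//.
    by move=> /orP[/eqP ->//|/hX].
  exists (inr false); apply/andP; split; apply/forall_inP => z; rewrite !inE//.
  by move=> /orP[/eqP ->//|/hY].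
- move=> [[a X] Y] [u|b] _; split; rewrite /IN /OUT /= ?finset.sub0set//.
  + by apply/fintype.subsetP => z; rewrite !inE => ->.
  + by apply/pred0P => z; rewrite /= !inE andbF.
  + apply/fintype.subsetP => z; case: b; rewrite !inE => /orP[] ->; rewrite ?orbT//.
  + by apply/pred0P => z; rewrite /= !inE.
- move=> [[a X] Y]; rewrite inE /= => /and5P[aX aY dXY /eqP cX /eqP cY].
  rewrite big_sumType/= big_bool/= (bigD1 tt)//= big1 => [|[]//].
  by rewrite !cardsU1 aX aY cX cY !cards0 cards1 !expr0 expr1 mulr1 !mul1r addr0.
- by rewrite addr_ge0// mulrn_wge0// exprn_ge0.
Qed.

(** For [r = 2] the overlapping labels could exceed 1 in total. Here one vertex is kept on each side
    and the labels are disjoint: joined to [a]; missing [a] and [px]; missing [a] and [py] but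
    joined to [px]. With [q = 1 - p] their sum is [p + q^2 + p q^2 = 1 - p^2 q]. *)
Lemma Gnp_two_sides_dense (r : nat) : (0 < r)%N -> Gnp_prob p (@two_sides n r) <=
  (n * 'C(n, r) * 'C(n, r))%:R *
  ((1 - p) ^+ (r + r + r * r) * (1 - p ^+ 2 * (1 - p)) ^+ (n - (r + r).+1)).
Proof.
move=> r_gt0.
(* The default is never taken on [A r], since both sides have [r > 0] vertices. *)
pose px (t : TT) := odflt t.1.1 [pick x in t.1.2].
pose py (t : TT) := odflt t.1.1 [pick y in t.2].
have pxX t : t \in A r -> px t \in t.1.2.
  case: t => [[a X] Y]; rewrite inE /= => /and5P[_ _ _ /eqP cX _].
  rewrite /px; case: pickP => //= X0.
  by move: r_gt0; rewrite -cX eq_card0.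
have pyY t : t \in A r -> py t \in t.2.
  case: t => [[a X] Y]; rewrite inE /= => /and5P[_ _ _ _ /eqP cX].
  rewrite /py; case: pickP => //= X0.
  by move: r_gt0; rewrite -cX eq_card0.
pose IN (t : TT) (l : unit + bool) : {set 'I_n} :=
  match l with inl _ => [set t.1.1] | inr true => finset.set0 | inr false => [set px t] end.
pose OUT (t : TT) (l : unit + bool) : {set 'I_n} :=
  match l with inl _ => finset.set0 | inr true => [set t.1.1; px t]
  | inr false => [set t.1.1; py t] end.
apply: (@Gnp_two_sides_labelled _ _ (inl tt) IN OUT).
- move=> t E w tA /= h.
  have [aw|naw] := boolP (adj E t.1.1 w).
    exists (inl tt); apply/andP; split; apply/forall_inP => z; rewrite inE//.
    by move=> /eqP ->.
  have [xw|nxw] := boolP (adj E (px t) w); last first.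
    exists (inr true); apply/andP; split; apply/forall_inP => z; rewrite !inE//.
    by move=> /orP[] /eqP ->.
  case: h => [|/(_ _ (pxX _ tA))|/(_ _ (pyY _ tA)) nyw]; first by rewrite (negbTE naw).
    by rewrite xw.
  exists (inr false); apply/andP; split; apply/forall_inP => z; rewrite !inE//.
    by move=> /eqP ->.
  by move=> /orP[] /eqP ->.
- move=> t [u|b] tA; split; rewrite /IN /OUT /= ?finset.sub0set//.
  + by apply/fintype.subsetP => z; rewrite !inE => ->.
  + by apply/pred0P => z; rewrite /= !inE andbF.
  + case: b; rewrite ?finset.sub0set//.
    by apply/fintype.subsetP => z; rewrite !inE => /eqP ->; rewrite pxX// orbT.
  + case: b; apply/fintype.subsetP => z; rewrite !inE => /orP[/eqP ->|/eqP ->];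
      by rewrite ?eqxx// ?pxX ?pyY ?orbT.
  + case: b; first by apply/pred0P => z; rewrite /= !inE.
    apply/pred0P => z; rewrite /= !inE; apply/negP => /andP[/eqP ->].
    move: (pxX _ tA) (pyY _ tA) (tA); rewrite inE => xX yY /and5P[aX _ dXY _ _].
    move=> /orP[] /eqP ex; first by rewrite -ex xX in aX.
    by rewrite -ex (disjointFr dXY xX) in yY.
- move=> t tA.
  move: (pxX _ tA) (pyY _ tA) (tA); rewrite inE => xX yY /and5P[aX aY dXY _ _].
  rewrite big_sumType/= big_bool/= (bigD1 tt)//= big1 => [|[]//].
  have ax : t.1.1 != px t by apply: contraNneq aX => ->.
  have ay : t.1.1 != py t by apply: contraNneq aY => ->.
  rewrite !cards2 ax ay/= !cards0 !cards1 !expr0 !expr1 mulr1 !mul1r addr0.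
  by rewrite le_eqVlt; apply/orP; left; apply/eqP; ring.
- have /andP[_ p_le1] := p01.
  by rewrite subr_ge0 mulr_ile1 ?exprn_ge0 ?exprn_ile1// gerBl.
Qed.

End TwoSides.

(** * Components of the complement of a star *)

Section Components.
Variable n : nat.
Implicit Types (E : {set {set 'I_n}}) (a x y w : 'I_n) (S K X Y W : {set 'I_n}).

Lemma mem_comp_in E S x : x \in S -> x \in comp_in E S x.
Proof. by move=> xS; rewrite inE xS connect0. Qed.

Lemma comp_in_sub E S x : comp_in E S x \subset S.
Proof. by apply/fintype.subsetP => y; rewrite inE => /andP[]. Qed.

Lemma adj_in_sym E S : symmetric (adj_in E S).
Proof. by move=> x y; rewrite /adj_in adjC andbCA. Qed.

Lemma comp_in_adj E S x z w :
  z \in comp_in E S x -> w \in S -> adj E z w -> w \in comp_in E S x.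
Proof.
rewrite !inE => /andP[zS xz] wS zw; rewrite wS/=.
by apply: connect_trans xz (connect1 _); rewrite /adj_in zS wS zw.
Qed.

Lemma disjoint_comp_in E S x y : x \in S -> y \in S ->
  comp_in E S x != comp_in E S y -> [disjoint comp_in E S x & comp_in E S y].
Proof.
move=> xS yS; apply: contraNT => /pred0Pn[z /=].
have csym := sym_connect_sym (@adj_in_sym E S).
rewrite !inE => /andP[/andP[_ xz] /andP[_ yz]]; apply/eqP/finset.setP => w.
rewrite !inE; congr (_ && _); apply: (same_connect csym).
by apply: connect_trans xz _; rewrite csym.
Qed.

Lemma comp_in_edge E S x : x \in S -> (1 < #|comp_in E S x|)%N ->
  exists2 y, y \in comp_in E S x & adj E x y.
Proof.
move=> xS c1; have /card_gt1P[u [v [uK vK uv]]] := c1.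
have [w wK wx] : exists2 w, w \in comp_in E S x & w != x.
  by have [ux|] := eqVneq u x; [exists v; rewrite // -ux eq_sym | exists u].
(* The first step of a path from [x] to [w] is the wanted edge. *)
move: wK; rewrite inE => /andP[wS /connectP[[|y s]/=]].
  by move=> _ wx'; rewrite wx' eqxx in wx.
move=> /andP[/and3P[_ yS xy] _] _; exists y => //.
exact: comp_in_adj (mem_comp_in _ xS) yS xy.
Qed.

Lemma notin_star E a x : (x \in ~: star E a) = (x != a) && ~~ adj E a x.
Proof. by rewrite !inE negb_or. Qed.

(** The witness [K] is the whole component: a vertex outside the star joined to it would belong to
    it. *)
Lemma small_side_comp E a x : x \in ~: star E a ->
  (1 < #|comp_in E (~: star E a) x|)%N ->
  small_side #|comp_in E (~: star E a) x| E.
Proof.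
set S := ~: star E a => xS c1; have [y yK xy] := comp_in_edge xS c1.
have KS z : z \in comp_in E S x -> (z != a) && ~~ adj E a z.
  by move/(fintype.subsetP (comp_in_sub _ _ _)); rewrite notin_star.
exists a, (comp_in E S x), x, y; split; split => //.
- by apply/negP => /KS; rewrite eqxx.
- exact: mem_comp_in.
- by case/andP: xy.
- by move=> z /KS /andP[].
move=> w wa wK; have [aw|naw] := boolP (adj E a w); [by left|right => z zK].
apply: contraNN wK; apply: comp_in_adj => //.
by rewrite notin_star wa naw.
Qed.

Lemma sub_card (T : finType) (B : {set T}) r : (r <= #|B|)%N ->
  exists2 X : {set T}, X \subset B & #|X| = r.
Proof.
move=> rB; exists [set x in take r (enum B)].
  by apply/fintype.subsetP => x; rewrite inE => /mem_take; rewrite mem_enum.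
rewrite cardsE; apply: etrans (card_uniqP _) _; first by rewrite take_uniq ?enum_uniq.
by rewrite size_takel// -cardE.
Qed.

Lemma two_sides_comp E a x y r : x \in ~: star E a -> y \in ~: star E a ->
  comp_in E (~: star E a) x != comp_in E (~: star E a) y ->
  (r <= #|comp_in E (~: star E a) x|)%N -> (r <= #|comp_in E (~: star E a) y|)%N ->
  two_sides r E.
Proof.
set S := ~: star E a => xS yS xy rx ry.
have dxy := disjoint_comp_in xS yS xy.
have [X /fintype.subsetP XK cX] := sub_card rx.
have [Y /fintype.subsetP YK cY] := sub_card ry.
have KS u z : z \in comp_in E S u -> (z != a) && ~~ adj E a z.
  by move/(fintype.subsetP (comp_in_sub _ _ _)); rewrite notin_star.
exists a, X, Y; split; split => //.
- by apply/negP => /XK/KS; rewrite eqxx.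
- by apply/negP => /YK/KS; rewrite eqxx.
- apply/pred0P => z /=; apply/negP => /andP[/XK zx /YK zy].
  by rewrite (disjointFr dxy zx) in zy.
- by move=> z /XK/KS/andP[].
- by move=> z /YK/KS/andP[].
- move=> u v /XK uK /YK vK; apply/negP => uv.
  have vS : v \in S by exact: (fintype.subsetP (comp_in_sub _ _ _) _ vK).
  by have := comp_in_adj uK vS uv; rewrite (disjointFl dxy vK).
- move=> w wa _ _; have [aw|naw] := boolP (adj E a w); first by constructor 1.
  have wS : w \in S by rewrite notin_star wa naw.
  have [wK|wK] := boolP (w \in comp_in E S x).
    constructor 3 => z /YK zK; apply/negP => zw.
    by have := comp_in_adj zK wS zw; rewrite (disjointFr dxy wK).
  constructor 2 => z /XK zK; apply: contraNN wK; exact: comp_in_adj.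
Qed.

(** The event to be excluded for the second claim; two distinct components already make [a] a
    star-cut-vertex. *)
Definition two_large_comps E := exists a x y,
  [/\ x \in ~: star E a, y \in ~: star E a,
      (1 < #|comp_in E (~: star E a) x|)%N, (1 < #|comp_in E (~: star E a) y|)%N &
      comp_in E (~: star E a) x != comp_in E (~: star E a) y].

Lemma two_large_comps_sides E r : two_large_comps E ->
  (exists2 k, (1 < k < r)%N & small_side k E) \/ two_sides r E.
Proof.
move=> [a [x [y [xS yS cx cy xy]]]].
have [xr|rx] := ltnP #|comp_in E (~: star E a) x| r.
  by left; exists #|comp_in E (~: star E a) x|; [rewrite cx|exact: small_side_comp].
have [yr|ry] := ltnP #|comp_in E (~: star E a) y| r.
  by left; exists #|comp_in E (~: star E a) y|; [rewrite cy|exact: small_side_comp].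
by right; exact: (two_sides_comp xS yS xy rx ry).
Qed.

(** Of two components outside the star, either both have an edge, or one is a single vertex [x], all
    of whose neighbours then lie in the star; [y] is taken from the other component. *)
Lemma star_cut_vertex_comps E a : star_cut_vertex E a ->
  two_large_comps E \/ exists x y,
    [/\ a != x, a != y & x != y] /\
    [/\ ~~ adj E a x, ~~ adj E a y, ~~ adj E x y &
        forall w, w != a -> w != x -> adj E a w || ~~ adj E x w].
Proof.
move=> [x [y [xS yS xy]]].
have csym := sym_connect_sym (@adj_in_sym E (~: star E a)).
have xy_ne : comp_in E (~: star E a) x != comp_in E (~: star E a) y.
  apply: contraNneq xy => exy; have := mem_comp_in E yS.
  by rewrite -exy inE => /andP[].
have isolated u v : u \in ~: star E a -> v \in ~: star E a ->
    ~~ connect (adj_in E (~: star E a)) u v ->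
    (#|comp_in E (~: star E a) u| <= 1)%N ->
    exists x y, [/\ a != x, a != y & x != y] /\
    [/\ ~~ adj E a x, ~~ adj E a y, ~~ adj E x y &
        forall w, w != a -> w != x -> adj E a w || ~~ adj E x w].
  move=> uS vS uv /card_le1P cu; exists u, v.
  move: (uS) (vS); rewrite !notin_star => /andP[ua nau] /andP[va nav].
  split; split; rewrite 1?eq_sym//.
  - by apply: contraNneq uv => ->; exact: connect0.
  - by apply: contraNN uv => uv; apply: connect1; rewrite /adj_in uS vS.
  move=> w wa wu; apply: contraNT wu; rewrite negb_or negbK => /andP[naw uw].
  have wS : w \in ~: star E a by rewrite notin_star wa naw.
  have := cu _ (mem_comp_in _ uS) w.
  by rewrite (comp_in_adj (mem_comp_in _ uS) wS uw) inE => /esym.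
have [cx|cx] := leqP #|comp_in E (~: star E a) x| 1.
  by right; exact: (isolated x y).
have [cy|cy] := leqP #|comp_in E (~: star E a) y| 1.
  by right; apply: (isolated y x) => //; rewrite csym.
by left; exists a, x, y.
Qed.

(* The neighbours of a vertex isolated outside the star of [a] are all
   adjacent to [a]. *)
Lemma star_cut_vertex_configurations E a : star_cut_vertex E a ->
  [\/ two_large_comps E, has_degree 0 E, has_degree 1 E | two_common_neighbours E].
Proof.
move=> /star_cut_vertex_comps[?|[x [y [[ax ay xy] [nax nay nxy h]]]]]; first by constructor 1.
pose N := [set w | adj E x w].
have degN : has_degree #|N| E.
  exists x, N; split => //; first by rewrite inE /adj eqxx.
    by move=> w; rewrite inE.
  by move=> w _; rewrite inE.
have [N2|] := leqP 2 #|N|; last first.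
  by case: #|N| degN => [|[|]]// ? _; [constructor 2|constructor 3].
have [W /fintype.subsetP WN cW] := sub_card N2.
have xw w : w \in W -> adj E x w by move/WN; rewrite inE.
have wx w : w \in W -> w != x by move=> /xw/andP[]; rewrite eq_sym.
have wa w : w \in W -> w != a.
  by move=> /xw; apply: contraTneq => ->; rewrite adjC.
constructor 4; exists a, x, W; split; split => //.
- by apply/negP => /wa; rewrite eqxx.
- by apply/negP => /wx; rewrite eqxx.
- move=> w wW; rewrite xw// andbT.
  by have := h w (wa _ wW) (wx _ wW); rewrite xw// orbF.
- by move=> w wa' wx' _; exact: h.
Qed.

Lemma star_cut_vertex_triple E a : star_cut_vertex E a ->
  two_large_comps E \/ independent_triple E.
Proof.
move=> /star_cut_vertex_comps[?|[x [y [ne [nax nay nxy h]]]]]; first by left.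
by right; exists a, x, y; split => //; split => // w wa wx _; exact: h.
Qed.

End Components.

(** * Real estimates *)

Section Estimates.
Variable R : realType.
Implicit Types (p x t c e : R) (n k r m : nat).

(** The term of degree [j + 1] of the exponential series gives [(c t)^(j+1) <= (j+1)! e^(c t)],
    which leaves a spare factor [t] to absorb the constants. *)
Lemma exp_decay j c e : 0 < c -> 0 < e ->
  exists2 T, 1 <= T & forall t, T <= t -> t ^+ j * expR (- (c * t)) <= e.
Proof.
move=> c0 e0; pose M : R := j.+1`!%:R.
have M0 : 0 < M by rewrite ltr0n fact_gt0.
have ce0 : 0 < c ^+ j.+1 * e by rewrite mulr_gt0 ?exprn_gt0.
exists (1 + M / (c ^+ j.+1 * e)); first by rewrite lerDl divr_ge0 ?ltW.
move=> t Tt; have t0 : 0 < t.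
  by apply: lt_le_trans Tt; rewrite ltr_pwDl// divr_ge0 ?ltW.
rewrite expRN -/(_ / _) ler_pdivrMr ?expR_gt0// -(ler_pM2l M0).
have h : M <= c ^+ j.+1 * e * t.
  rewrite [leRHS]mulrC -ler_pdivrMr//; apply: le_trans Tt.
  by rewrite lerDr.
have h2 : (c * t) ^+ j.+1 <= M * expR (c * t).
  have := expR_ge1Dxn j (ltW (mulr_gt0 c0 t0)); rewrite -/M => h2.
  rewrite [leRHS]mulrC -ler_pdivrMr//; apply: le_trans h2; by rewrite lerDr.
apply: (@le_trans _ _ (c ^+ j.+1 * e * t * t ^+ j)).
  by rewrite ler_wpM2r// exprn_ge0// ltW.
have -> : c ^+ j.+1 * e * t * t ^+ j = e * (c * t) ^+ j.+1.
  by rewrite exprMn [t ^+ j.+1]exprS; ring.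
by rewrite mulrCA ler_wpM2l// ltW.
Qed.

Lemma exprN_le_expR x n : 0 <= x <= 1 -> (1 - x) ^+ n <= expR (- (x * n%:R)).
Proof.
move=> /andP[x0 x1]; rewrite -mulNr expRM_natr lerXn2r ?nnegrE ?expR_ge0//.
  by rewrite subr_ge0.
exact: expR_ge1Dx.
Qed.

(** Restoring the full exponent [n] costs a factor [e^(x m)]; truncated subtraction is harmless, as
    [n - m] only gets larger. *)
Lemma exprN_sub_le_expR x n m : 0 <= x <= 1 ->
  (1 - x) ^+ (n - m) <= expR (- (x * n%:R) + x * m%:R).
Proof.
move=> x01; apply: le_trans (exprN_le_expR _ x01) _.
have nm : (n%:R - m%:R : R) <= (n - m)%:R.
  have [mn|/ltnW nm] := leqP m n; first by rewrite natrB.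
  by rewrite (le_trans _ (ler0n _ _))// subr_le0 ler_nat.
move: x01 => /andP[x0 _]; rewrite ler_expR.
have := ler_wpM2l x0 nm; lra.
Qed.

Lemma ffact_le_expn n k : (n ^_ k <= n ^ k)%N.
Proof.
elim: k => [|k IHk]; first by rewrite ffactn0 expn0.
by rewrite ffactnSr expnSr leq_mul// leq_subr.
Qed.

Lemma bin_le_expn n k : ('C(n, k) <= n ^ k)%N.
Proof.
apply: leq_trans (ffact_le_expn n k).
by rewrite -bin_ffact leq_pmulr ?fact_gt0.
Qed.

(** One term of the exponential series yields [k^k <= k! e^k]. The bound [c] on [n / k] is left
    free: it is [n p] for the large sides and [n / k] for the small ones. *)
Lemma bin_le_expR n k c : (0 < k)%N -> n%:R <= k%:R * c ->
  ('C(n, k))%:R <= (expR 1 * c) ^+ k.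
Proof.
move=> k0 nkc; have f0 : 0 < (k`!%:R : R) by rewrite ltr0n fact_gt0.
have k0' : 0 < (k%:R : R) by rewrite ltr0n.
have c0 : 0 <= c by rewrite -(pmulr_rge0 _ k0') (le_trans _ nkc).
have kk : (k%:R ^+ k : R) <= k`!%:R * expR 1 ^+ k.
  rewrite -expRM_natl mulr1 mulrC -ler_pdivrMr//.
  case: k k0 {nkc f0 k0'} => // k _; apply: le_trans (expR_ge1Dxn k _) => //.
  by rewrite lerDr.
rewrite -(ler_pM2l f0) -natrM mulnC bin_ffact.
apply: (@le_trans _ _ (n%:R ^+ k)); first by rewrite -natrX ler_nat ffact_le_expn.
apply: (@le_trans _ _ ((k%:R * c) ^+ k)); first by rewrite lerXn2r ?nnegrE// mulr_ge0.
by rewrite !exprMn mulrA ler_wpM2r ?exprn_ge0.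
Qed.

(** In the induction, multiplying by [1 - p] leaves the gap [p^2 / 2 + k^2 p^3 / 2]. The exact
    linear term matters: it preserves the leading [e^(- n p)] per vertex of a small side. *)
Lemma exprN_le_quadratic p k : 0 <= p <= 1 ->
  (1 - p) ^+ k <= 1 - k%:R * p + (k%:R * p) ^+ 2 / 2.
Proof.
move=> /andP[p0 p1]; elim: k => [|k IHk]; first by rewrite expr0; lra.
rewrite exprSr; apply: le_trans (ler_wpM2r _ IHk) _; first by lra.
rewrite -natr1; have : 0 <= (k%:R : R) by [].
set a := k%:R => a0; rewrite -subr_ge0.
rewrite (_ : _ - _ = p ^+ 2 / 2 + a ^+ 2 * p ^+ 3 / 2); last by field.
by rewrite addr_ge0// divr_ge0// ?mulr_ge0// exprn_ge0.
Qed.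

(** From [e >= (5/4)^4]; this precision makes [1/32 + 2 / e] at most 7/8. *)
Lemma expRN1_lt : expR (- 1) <= 41 / 100 :> R.
Proof.
have h : 5 / 4 <= expR (1 / 4) :> R by apply: le_trans (expR_ge1Dx _); lra.
have h4 : (5 / 4) ^+ 4 <= expR 1 :> R.
  rewrite (_ : 1 = 4%:R * (1 / 4)) ?expRM_natl; last by lra.
  by rewrite lerXn2r ?nnegrE ?expR_ge0//; lra.
have h1 := expRxMexpNx_1 (1 : R).
have h0 : 0 <= expR (- 1) * (expR 1 - (5 / 4) ^+ 4) :> R.
  by rewrite mulr_ge0 ?expR_ge0// subr_ge0.
by rewrite mulrBr [expR (- 1) * expR 1]mulrC h1 in h0; lra.
Qed.

End Estimates.

(** * Low degrees, common neighbours, triples and dense sides *)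

Section Bounds.
Variable R : realType.
Implicit Types (p x t c e d T u : R) (n k r m : nat).

(** Hypothesis (i) at a fixed [n], for large [T] and small [d]: the last quantity is the exponential
    of [log n + log log n - n p]. *)
Definition above_threshold d T n p := [/\ 0 <= p <= 1, T <= ln n%:R,
  T <= n%:R * p & n%:R * ln n%:R * expR (- (n%:R * p)) <= d].

Lemma natr_expR_ln n : 0 < ln (n%:R : R) -> n%:R = expR (ln n%:R) :> R.
Proof.
move=> l0; rewrite lnK// posrE ltr0n lt0n; apply: contraTneq l0 => ->.
by rewrite ln0 ?ltxx.
Qed.

(** With [t = n p], degree 1 dominates and contributes about [t n e^-t]. In [C], the 2 accounts for
    the two degrees and [e^2] for the lost exponents. *)
Lemma degree_bound_small e : 0 < e -> exists2 d, 0 < d & exists T, forall n p,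
  above_threshold d T n p ->
  (n * 'C(n, 0))%:R * (p ^+ 0 * (1 - p) ^+ (n - 1 - 0)) +
  (n * 'C(n, 1))%:R * (p ^+ 1 * (1 - p) ^+ (n - 1 - 1)) <= e.
Proof.
move=> e0; pose C : R := 2 * expR 2.
have C0 : 0 < C by rewrite mulr_gt0// expR_gt0.
exists (e / (2 * C)); first by rewrite divr_gt0// mulr_gt0.
have e'0 : 0 < e / C by rewrite divr_gt0.
have [T T1 hT] := @exp_decay R 1 (1/2) (e / C) ltac:(lra) e'0.
exists T => n p [p01 Tl Tt hd].
have l1 : 1 <= ln (n%:R : R) by apply: le_trans Tl.
have nE := natr_expR_ln (lt_le_trans ltr01 l1).
set t := n%:R * p in Tt hd *.
have t1 : 1 <= t by apply: le_trans Tt.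
have n0 : 0 <= (n%:R : R) by [].
have main : t * (n%:R * expR (- t)) <= e / C.
  (* For [t] of order [log n] the threshold quantity controls [t n e^-t]; beyond that,
     [n <= e^(t/2)] leaves exponential decay in [t]. *)
  have [tl|lt] := lerP t (2 * ln n%:R).
    apply: (@le_trans _ _ (2 * ln n%:R * (n%:R * expR (- t)))).
      apply: ler_wpM2r => //; rewrite mulr_ge0 ?expR_ge0.
    move: hd; rewrite [e / (2 * C)](_ : _ = e / C / 2); last first.
      by rewrite invfM [2^-1 * _]mulrC mulrA.
    lra.
  apply: le_trans (hT t Tt); rewrite expr1 ler_wpM2l//; first by lra.
  rewrite [X in X * _]nE -expRD ler_expR; lra.
have q0 : 0 <= 1 - p by case/andP: p01 => ? ?; lra.
have b1 : (1 - p) ^+ (n - 1 - 0) <= expR 2 * expR (- t).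
  rewrite subn0; apply: le_trans (exprN_sub_le_expR _ _ p01) _.
  rewrite -expRD ler_expR mulr1 [p * _]mulrC -/t; case/andP: p01 => ? ?; lra.
have b2 : (1 - p) ^+ (n - 1 - 1) <= expR 2 * expR (- t).
  rewrite -subnDA; apply: le_trans (exprN_sub_le_expR _ _ p01) _.
  rewrite -expRD ler_expR [p * n%:R]mulrC -/t; case/andP: p01 => ? ?; lra.
rewrite bin0 bin1 muln1 expr0 mul1r expr1 natrM.
have -> : n%:R * n%:R * (p * (1 - p) ^+ (n - 1 - 1)) =
          t * n%:R * (1 - p) ^+ (n - 1 - 1) by rewrite /t; ring.
have h1 := ler_wpM2l n0 b1.
have tn0 : 0 <= t * n%:R by rewrite mulr_ge0//; lra.
have h2 := ler_wpM2l tn0 b2.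
apply: le_trans (lerD h1 h2) _.
have : 0 <= n%:R * (expR 2 * expR (- t)) * (t - 1).
  by rewrite !mulr_ge0 ?expR_ge0//; lra.
by move: main; rewrite ler_pdivlMr// /C; lra.
Qed.

(** Since [1 - p >= 1/2], the bound is of order [t^4 e^(-t/2)] with [t = n p]. *)
Lemma common_neighbours_bound_small e : 0 < e -> exists T, forall n p,
  0 <= p <= 1 / 32 -> T <= n%:R * p ->
  (n * n * 'C(n, 2))%:R *
    (p ^+ 4 * (1 - p) ^+ 1 * (1 - p * (1 - p)) ^+ (n - 4)) <= e.
Proof.
move=> e0; pose C : R := expR 4.
have C0 : 0 < C by rewrite expR_gt0.
have e'0 : 0 < e / C by rewrite divr_gt0.
have [T T1 hT] := @exp_decay R 4 (1/2) (e / C) ltac:(lra) e'0.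
exists T => n p /andP[p0 p1] Tt.
set t := n%:R * p in Tt *.
have x01 : 0 <= p * (1 - p) <= 1 by nra.
have b1 : (1 - p * (1 - p)) ^+ (n - 4) <= C * expR (- (1 / 2 * t)).
  apply: le_trans (exprN_sub_le_expR _ _ x01) _; rewrite -expRD ler_expR /t.
  have n0 : 0 <= (n%:R : R) by [].
  have : 0 <= n%:R * (p * (1 / 2 - p)) by rewrite !mulr_ge0//; lra.
  case/andP: x01 => ? ?; lra.
have t4 : t ^+ 4 * expR (- (1 / 2 * t)) * C <= e by rewrite -ler_pdivlMr// hT.
apply: le_trans t4.
have cn : (n * n * 'C(n, 2))%:R <= (n%:R ^+ 4 : R).
  rewrite -natrX ler_nat (_ : n ^ 4 = n * n * n ^ 2)%N; last by rewrite mulnn -expnD.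
  by rewrite leq_mul// bin_le_expn.
have -> : t ^+ 4 * expR (- (1 / 2 * t)) * C =
  n%:R ^+ 4 * (p ^+ 4 * 1 * (C * expR (- (1 / 2 * t)))) by rewrite /t; ring.
have X0 : 0 <= (1 - p * (1 - p)) ^+ (n - 4) by rewrite exprn_ge0//; lra.
apply: ler_pM => //.
  by rewrite !mulr_ge0 ?exprn_ge0//; lra.
apply: ler_pM => //; first by rewrite !mulr_ge0 ?exprn_ge0//; lra.
by rewrite ler_wpM2l ?exprn_ge0// expr1; lra.
Qed.

(** With [u = n (1 - p)] and [p >= 1/32], the bound is of order [u^3 e^(-u/32)]. *)
Lemma triple_bound_small e : 0 < e -> exists T, forall n p,
  1 / 32 <= p <= 1 -> T <= n%:R * (1 - p) ->
  (n ^ 3)%:R * ((1 - p) ^+ 3 * (1 - p * (1 - p)) ^+ (n - 3)) <= e.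
Proof.
move=> e0; pose C : R := expR 3.
have C0 : 0 < C by rewrite expR_gt0.
have e'0 : 0 < e / C by rewrite divr_gt0.
have [T T1 hT] := @exp_decay R 3 (1/32) (e / C) ltac:(lra) e'0.
exists T => n p /andP[p0 p1] Tt.
set u := n%:R * (1 - p) in Tt *.
have n0 : 0 <= (n%:R : R) by [].
have u0 : 0 <= u by rewrite mulr_ge0//; lra.
have x01 : 0 <= p * (1 - p) <= 1 by nra.
have b1 : (1 - p * (1 - p)) ^+ (n - 3) <= C * expR (- (1 / 32 * u)).
  apply: le_trans (exprN_sub_le_expR _ _ x01) _; rewrite -expRD ler_expR.
  have : 0 <= u * (p - 1 / 32) by rewrite !mulr_ge0//; lra.
  rewrite /u; case/andP: x01 => ? ?; lra.
have t4 : u ^+ 3 * expR (- (1 / 32 * u)) * C <= e by rewrite -ler_pdivlMr// hT.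
apply: le_trans t4; rewrite natrX mulrA -exprMn -/u -mulrA [expR _ * C]mulrC.
by rewrite ler_wpM2l// exprn_ge0.
Qed.

(** Here the prefactor [u^3] alone, with [u = n (1 - p) <= 1], is at most [u]. *)
Lemma triple_bound_small_codegree e : 0 < e -> exists2 d, 0 < d & forall n p,
  0 <= p <= 1 -> n%:R * (1 - p) <= d ->
  (n ^ 3)%:R * ((1 - p) ^+ 3 * (1 - p * (1 - p)) ^+ (n - 3)) <= e.
Proof.
move=> e0; exists (Num.min 1 e); first by rewrite lt_min ltr01.
move=> n p /andP[p0 p1]; rewrite le_min => /andP[u1 ue].
have x01 : 0 <= 1 - p * (1 - p) <= 1 by nra.
rewrite natrX mulrA -exprMn; set u := n%:R * (1 - p) in u1 ue *.
have u0 : 0 <= u by rewrite mulr_ge0//; lra.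
apply: (@le_trans _ _ (u * 1)); last by rewrite mulr1.
apply: ler_pM; rewrite ?exprn_ge0//; try by case/andP: x01.
  by rewrite exprS -[leRHS]mulr1 ler_wpM2l// exprn_ile1.
by case/andP: x01 => ? ?; rewrite exprn_ile1.
Qed.

(** With [q = 1 - p] and [u = n q], the bound is of order [u^5 q^3 e^(-c u)]. It is small for every
    [u]: large [u] gives exponential decay, and bounded [u] forces [q] to be small. *)
Lemma dense_sides_bound_small e : 0 < e -> exists N : R, forall n p,
  1 / 32 <= p <= 1 -> N <= n%:R ->
  (n * 'C(n, 2) * 'C(n, 2))%:R * ((1 - p) ^+ (2 + 2 + 2 * 2) *
    (1 - p ^+ 2 * (1 - p)) ^+ (n - (2 + 2).+1)) <= e.
Proof.
move=> e0; pose C : R := expR 5; pose c : R := (1 / 32) ^+ 2.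
have C0 : 0 < C by rewrite expR_gt0.
have c0 : 0 < c by rewrite exprn_gt0//; lra.
have e'0 : 0 < e / C by rewrite divr_gt0.
have [U U1 hU] := @exp_decay R 5 c (e / C) c0 e'0.
have U0 : 0 < U by apply: lt_le_trans U1.
(* Chosen so that [n q < U] implies [U^5 C q <= e]. *)
exists (U * (U ^+ 5 * C / e + 1)) => n p /andP[p0 p1] Nn.
set u := n%:R * (1 - p); set q := 1 - p.
have q0 : 0 <= q by rewrite /q; lra.
have q1 : q <= 1 by rewrite /q; lra.
have n0 : 0 <= (n%:R : R) by [].
have u0 : 0 <= u by rewrite mulr_ge0.
have p2 : c <= p ^+ 2 <= 1.
  by rewrite lerXn2r ?nnegrE ?exprn_ile1//; lra.
have x01 : 0 <= p ^+ 2 * q <= 1.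
  by case/andP: p2 => ? ?; rewrite mulr_ge0 ?mulr_ile1//; lra.
have b1 : (1 - p ^+ 2 * q) ^+ (n - 5) <= C * expR (- (c * u)).
  apply: le_trans (exprN_sub_le_expR _ _ x01) _; rewrite -expRD ler_expR.
  have : 0 <= u * (p ^+ 2 - c) by rewrite !mulr_ge0//; lra.
  rewrite /u -/q; case/andP: x01 => ? ?; lra.
have cn : (n * 'C(n, 2) * 'C(n, 2))%:R <= (n%:R ^+ 5 : R).
  rewrite -natrX ler_nat (_ : n ^ 5 = n * n ^ 2 * n ^ 2)%N; last by rewrite -expnS -expnD.
  by rewrite !leq_mul// bin_le_expn.
apply: (@le_trans _ _ (u ^+ 5 * expR (- (c * u)) * C * q ^+ 3)).
  have -> : u ^+ 5 * expR (- (c * u)) * C * q ^+ 3 =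
    n%:R ^+ 5 * (q ^+ 8 * (C * expR (- (c * u)))) by rewrite /u -/q; ring.
  have X0 : 0 <= (1 - p ^+ 2 * q) ^+ (n - 5) by rewrite exprn_ge0//; lra.
  apply: ler_pM => //; first by apply: mulr_ge0 X0; exact: exprn_ge0.
  by apply: ler_wpM2l b1; exact: exprn_ge0.
have [Uu|uU] := lerP U u.
  rewrite -[leRHS]mulr1; apply: ler_pM; rewrite ?exprn_ge0 ?exprn_ile1//.
    by rewrite !mulr_ge0 ?exprn_ge0 ?expR_ge0// ltW.
  by rewrite -ler_pdivlMr// hU.
have hq : U ^+ 5 * C * q <= e.
  have h0 : 0 <= U ^+ 5 * C / e by rewrite divr_ge0 ?mulr_ge0 ?exprn_ge0 ?ltW.
  have h1 : (U ^+ 5 * C / e + 1) * q <= 1.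
    rewrite -(ler_pM2l U0) mulrA mulr1 (le_trans _ (ltW uU))// /u -/q.
    by rewrite ler_wpM2r.
  have h2 : U ^+ 5 * C / e * q <= 1 by lra.
  have -> : U ^+ 5 * C * q = U ^+ 5 * C / e * q * e by rewrite [RHS]mulrAC divfK// gt_eqF.
  by rewrite -[leRHS]mul1r ler_wpM2r// ltW.
apply: le_trans hq.
have -> : U ^+ 5 * C * q = U ^+ 5 * 1 * C * q by rewrite mulr1.
apply: ler_pM; rewrite ?exprn_ge0 ?mulr_ge0 ?expR_ge0 ?exprn_ge0 ?(ltW C0)//.
  rewrite ler_wpM2r ?(ltW C0)//; apply: ler_pM; rewrite ?exprn_ge0 ?expR_ge0//.
    by rewrite lerXn2r ?nnegrE ?(ltW U0)// ltW.
  by rewrite expR_le1 oppr_le0 mulr_ge0// ltW.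
by rewrite exprS -[leRHS]mulr1 ler_wpM2l// exprn_ile1.
Qed.

End Bounds.

(** * Large and small sides for [p] at most 1/32 *)

Section SparseBounds.
Variable R : realType.
Implicit Types (p x t c e d T u : R) (n k r m : nat).

(** With [r] about [1 / p], each outside vertex costs a factor at most 7/8, while each choice of a
    side costs only [e^(n/64)]. *)
Lemma sparse_sides_bound_small e : 0 < e -> exists T, forall n p r,
  0 <= p <= 1 / 32 -> T <= n%:R * p -> 1 <= r%:R * p -> r%:R * p <= 2 ->
  (n * 'C(n, r) * 'C(n, r))%:R * ((1 - p) ^+ (r + r + r * r) *
    (p + (1 - p) ^+ r.+1 *+ 2) ^+ (n - (r + r).+1)) <= e.
Proof.
move=> e0; pose C : R := expR (1 / 8).
have C0 : 0 < C by rewrite expR_gt0.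
have e'0 : 0 < e / C by rewrite divr_gt0.
have [T1 T11 hT1] := @exp_decay R 1 (1/128) (expR (- 1)) ltac:(lra) (expR_gt0 _).
have [T2 T21 hT2] := @exp_decay R 1 (5/64) (e / C) ltac:(lra) e'0.
exists (T1 + T2 + 32) => n p r /andP[p0 p1] Tt rp1 rp2.
set t := n%:R * p in Tt.
have n0 : 0 <= (n%:R : R) by [].
have r0 : 0 <= (r%:R : R) by [].
have r_gt0 : (0 < r)%N.
  by rewrite lt0n; apply: contraTneq rp1 => ->; rewrite mul0r -ltNge ltr01.
have tn : t <= n%:R by rewrite /t -[leRHS]mulr1 ler_wpM2l//; lra.
have rt : r%:R * t <= 2 * n%:R.
  by rewrite /t mulrCA [2 * _]mulrC ler_wpM2l.
have nrt : n%:R <= r%:R * t.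
  by rewrite /t mulrCA -[leLHS]mulr1 ler_wpM2l.
have q0 : 0 <= 1 - p by lra.
have bin : ('C(n, r))%:R <= expR (n%:R / 64) :> R.
  apply: le_trans (bin_le_expR r_gt0 nrt) _.
  (* [T1] was chosen for this; as [r t <= 2 n], the [r]-th power is at most [e^(n/64)]. *)
  have h : expR 1 * t <= expR (1 / 128 * t).
    have := ler_wpM2r (expR_ge0 (1 + 1 / 128 * t)) (hT1 t ltac:(lra)).
    have e1 : expR (- (1 / 128 * t)) * expR (1 + 1 / 128 * t) = expR 1.
      by rewrite -expRD; congr expR; lra.
    have e2 : expR (- 1) * expR (1 + 1 / 128 * t) = expR (1 / 128 * t).
      by rewrite -expRD; congr expR; lra.
    by rewrite expr1 -[leLHS]mulrA e1 e2 mulrC.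
  apply: (@le_trans _ _ (expR (1 / 128 * t) ^+ r)).
    by rewrite lerXn2r ?nnegrE ?expR_ge0// mulr_ge0 ?expR_ge0//; lra.
  by rewrite -expRM_natl ler_expR; lra.
have base : p + (1 - p) ^+ r.+1 *+ 2 <= 1 - 1 / 8.
  have : (1 - p) ^+ r.+1 <= 41 / 100.
    apply: le_trans (@expRN1_lt R); apply: (@le_trans _ _ ((1 - p) ^+ r)).
      by rewrite exprS -[leRHS]mul1r ler_wpM2r ?exprn_ge0//; lra.
    apply: le_trans (exprN_le_expR _ _) _; first by lra.
    by rewrite ler_expR; lra.
  rewrite mulr2n; lra.
have base0 : 0 <= p + (1 - p) ^+ r.+1 *+ 2.
  by rewrite addr_ge0// mulrn_wge0// exprn_ge0.
(* From [t >= 32] follows [r <= n / 16], so the missing [2 r] factors cost at most [e^(n/64)] out of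
   [e^(-n/8)]; [C] covers the last one. *)
have pow : (p + (1 - p) ^+ r.+1 *+ 2) ^+ (n - (r + r).+1) <=
           expR (- (7 / 64 * n%:R)) * C.
  apply: (@le_trans _ _ ((1 - 1 / 8) ^+ (n - (r + r).+1))).
    by rewrite lerXn2r ?nnegrE//; lra.
  apply: le_trans (exprN_sub_le_expR _ _ _) _; first by lra.
  rewrite -expRD ler_expR -[(r + r).+1%:R]natr1 natrD.
  have : 0 <= r%:R * (t - 32) by rewrite mulr_ge0//; lra.
  lra.
apply: (@le_trans _ _ (n%:R * expR (n%:R / 64) * expR (n%:R / 64) *
   (1 * (expR (- (7 / 64 * n%:R)) * C)))).
  rewrite !natrM; apply: ler_pM; rewrite ?mulr_ge0 ?exprn_ge0//.
    by apply: ler_pM; rewrite ?mulr_ge0// ler_wpM2l.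
  apply: ler_pM; rewrite ?exprn_ge0 ?exprn_ile1//; lra.
have -> : n%:R * expR (n%:R / 64) * expR (n%:R / 64) *
   (1 * (expR (- (7 / 64 * n%:R)) * C)) =
   n%:R ^+ 1 * (expR (n%:R / 64) * expR (n%:R / 64) * expR (- (7 / 64 * n%:R))) * C :> R.
  by ring.
rewrite -!expRD -ler_pdivlMr//; apply: le_trans (hT2 n%:R _); last by lra.
apply: ler_wpM2l; first by rewrite expr1.
rewrite ler_expR; lra.
Qed.

(** Per-vertex cost of a side with [k] vertices: [e n / k] from the binomial, [e^2] from the
    [k + 1 <= 2 k] lost exponents, and the remaining exponential from the labels. *)
Let base n p k : R :=
  expR 3 * (n%:R / k%:R) * expR (- (n%:R * p) + n%:R * p * p + n%:R * p * (k%:R * p) / 2).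

Let small_side_term n p k : 0 <= p <= 1 -> (0 < k)%N -> k%:R * p <= 1 ->
  (n * 'C(n, k) * k ^ 2)%:R *
    (p ^+ 1 * (1 - p) ^+ k * (p + (1 - p) ^+ k.+1) ^+ (n - k.+1)) <=
  n%:R * p * k%:R ^+ 2 * base n p k ^+ k.
Proof.
move=> p01 k_gt0 kp1; have /andP[p0 p1] := p01.
have q0 : 0 <= 1 - p by lra.
have n0 : 0 <= (n%:R : R) by [].
have k0 : 0 < (k%:R : R) by rewrite ltr0n.
have k1 : 1 <= (k%:R : R) by rewrite ler1n.
have kp0 : 0 <= k%:R * p by rewrite mulr_ge0 ?(ltW k0).
pose x := (1 - p) * (k%:R * p * (1 - k%:R * p / 2)).
have h0 : 0 <= k%:R * p * (1 - k%:R * p / 2) <= 1.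
  by move: kp0 kp1; set y := k%:R * p => y0 y1; apply/andP; split; nra.
have x01 : 0 <= x <= 1.
  move: h0 => /andP[? ?]; rewrite mulr_ge0//= mulr_ile1//; lra.
have bx : p + (1 - p) ^+ k.+1 <= 1 - x.
  have := ler_wpM2l q0 (exprN_le_quadratic k p01); rewrite -exprS /x; lra.
have b0 : 0 <= p + (1 - p) ^+ k.+1 by rewrite addr_ge0// exprn_ge0.
have pow : (p + (1 - p) ^+ k.+1) ^+ (n - k.+1) <=
   (expR 2 * expR (- (n%:R * p) + n%:R * p * p + n%:R * p * (k%:R * p) / 2)) ^+ k.
  apply: (@le_trans _ _ ((1 - x) ^+ (n - k.+1))).
    by rewrite lerXn2r ?nnegrE//; lra.
  apply: le_trans (exprN_sub_le_expR _ _ x01) _.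
  rewrite -expRD -expRM_natl ler_expR -[k.+1%:R]natr1.
  have : 0 <= k%:R * (1 - x) by case/andP: x01 => _ x1; rewrite mulr_ge0 ?(ltW k0)// subr_ge0.
  have : 0 <= n%:R * (k%:R * p) * (p * (k%:R * p / 2)).
    by rewrite !mulr_ge0//; lra.
  case/andP: x01 => _ x1; rewrite /x in x1 *; lra.
have bin : ('C(n, k))%:R <= (expR 1 * (n%:R / k%:R)) ^+ k :> R.
  by apply: bin_le_expR => //; rewrite mulrCA divff ?mulr1// gt_eqF.
rewrite !natrM -[k%:R * k%:R]expr2.
apply: (@le_trans _ _ (n%:R * (expR 1 * (n%:R / k%:R)) ^+ k * k%:R ^+ 2 *
  (p ^+ 1 * 1 * (expR 2 * expR (- (n%:R * p) + n%:R * p * p + n%:R * p * (k%:R * p) / 2)) ^+ k))).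
  apply: ler_pM; rewrite ?mulr_ge0 ?exprn_ge0//.
    by rewrite ler_wpM2r ?exprn_ge0// ler_wpM2l.
  apply: ler_pM; rewrite ?mulr_ge0 ?exprn_ge0//.
  by rewrite ler_wpM2l// exprn_ile1//; lra.
rewrite le_eqVlt; apply/orP; left; apply/eqP.
rewrite /base (_ : 3 = 1 + 2) ?expRD; last by lra.
by rewrite !exprMn; ring.
Qed.

(** The square is what sides with at least two vertices provide. With [t = n p], there are three
    cases: [t k p > 2], where [n / k <= t^2]; otherwise [t <= 2 log n], where the threshold quantity
    is used; otherwise [n <= e^(t/2)]. *)
Let base_small e : 0 < e -> exists2 d, 0 < d & exists T, forall n p k,
  above_threshold d T n p -> p <= 1 / 32 -> (0 < k)%N -> k%:R * p <= 1 ->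
  1 <= n%:R * p /\ n%:R * p * base n p k ^+ 2 <= e.
Proof.
move=> e0; pose C : R := expR 5 ^+ 2.
have E5 : expR 5 = expR 3 * expR 2 :> R by rewrite -expRD; congr expR; lra.
have C0 : 0 < C by rewrite exprn_gt0// expR_gt0.
have e'0 : 0 < e / C by rewrite divr_gt0.
have [T1 T11 hT1] := @exp_decay R 5 (1/2) (e / C) ltac:(lra) e'0.
have [T2 T21 hT2] := @exp_decay R 2 1 (1/4) ltac:(lra) ltac:(lra).
exists (Num.min 1 (e / C / 2)); first by rewrite lt_min ltr01 divr_gt0.
exists (T1 + T2) => n p k [/andP[p0 _] Tl Tt hd] p1 k_gt0 kp1.
have l1 : 1 <= ln (n%:R : R) by lra.
have nE := natr_expR_ln (lt_le_trans ltr01 l1).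
(* Ensures [t^2 <= n], that is [t p <= 1], whenever [t <= 2 log n]. *)
have l2 : ln n%:R ^+ 2 <= (n%:R : R) / 4.
  have := hT2 (ln n%:R) ltac:(lra); rewrite mul1r expRN -nE ler_pdivrMr.
    by lra.
  by rewrite nE expR_gt0.
have n0 : 0 < (n%:R : R) by rewrite nE expR_gt0.
have k0 : 0 < (k%:R : R) by rewrite ltr0n.
have k1 : 1 <= (k%:R : R) by rewrite ler1n.
rewrite /base; set t := n%:R * p in Tt hd *.
have t1 : 1 <= t by lra.
have t0 : 0 <= t by lra.
split=> //; set b := expR 3 * _ * _.
have b0 : 0 <= b by rewrite !mulr_ge0 ?expR_ge0// divr_ge0// ltW.
have tp32 : t * p <= t / 32.
  have : 0 <= t * (1 / 32 - p) by rewrite mulr_ge0//; lra.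
  lra.
have kp0 : 0 <= k%:R * p by rewrite mulr_ge0 ?(ltW k0).
have sq y : 0 <= y -> b <= expR 5 * y -> t * b ^+ 2 <= C * (t * y ^+ 2).
  move=> y0 by_; have -> : C * (t * y ^+ 2) = t * (expR 5 * y) ^+ 2 by rewrite /C; ring.
  rewrite ler_wpM2l//.
  by rewrite lerXn2r ?nnegrE// mulr_ge0// expR_ge0.
have big : b <= expR 5 * (t ^+ 2 * expR (- (1 / 4 * t))) -> t * b ^+ 2 <= e.
  move=> /sq; rewrite mulr_ge0 ?exprn_ge0 ?expR_ge0// => /(_ isT) h.
  apply: le_trans h _; rewrite mulrC -ler_pdivlMr//.
  apply: le_trans (hT1 t _); last by lra.
  rewrite exprMn -exprM -expRM_natl mulrA -exprS ler_wpM2l ?exprn_ge0//.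
  by rewrite ler_expR; lra.
have [ktp|ktp] := lerP (t * (k%:R * p)) 2; last first.
  apply: big; apply: (@le_trans _ _ (expR 3 * t ^+ 2 * expR (- (1 / 4 * t)))).
    have nk : n%:R / k%:R <= t ^+ 2.
      rewrite ler_pdivrMr//; have : 0 <= n%:R * (t * (k%:R * p) - 2).
        by rewrite mulr_ge0 ?(ltW n0)// subr_ge0 ltW.
      rewrite /t; lra.
    apply: ler_pM; rewrite ?mulr_ge0 ?expR_ge0 ?divr_ge0 ?(ltW n0) ?(ltW k0)//.
      by rewrite ler_wpM2l// expR_ge0.
    rewrite ler_expR; have : 0 <= t * (1 - k%:R * p) by rewrite mulr_ge0//; lra.
    lra.
  rewrite -mulrA; apply: ler_wpM2r; first by rewrite mulr_ge0 ?exprn_ge0 ?expR_ge0.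
  by rewrite ler_expR; lra.
have nk : n%:R / k%:R <= (n%:R : R).
  by rewrite ler_pdivrMr// -[leLHS]mulr1 ler_wpM2l// ltW.
have bn : b <= expR 3 * n%:R * expR (- t + t * p + 1).
  apply: ler_pM; rewrite ?mulr_ge0 ?expR_ge0 ?divr_ge0 ?(ltW n0) ?(ltW k0)//.
    by rewrite ler_wpM2l// expR_ge0.
  by rewrite ler_expR; lra.
have [tl|lt] := lerP t (2 * ln n%:R).
  have tp1 : t * p <= 1.
    rewrite -(ler_pM2l n0) mulr1 mulrCA -/t -expr2.
    apply: (@le_trans _ _ ((2 * ln n%:R) ^+ 2)); first by rewrite lerXn2r ?nnegrE//; lra.
    by rewrite exprMn; lra.
  have : b <= expR 5 * (n%:R * expR (- t)).
    apply: le_trans bn _; rewrite E5.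
    rewrite -[leLHS]mulrA -[leRHS]mulrA; apply: ler_wpM2l; first exact: expR_ge0.
    rewrite [leRHS]mulrCA; apply: ler_wpM2l; first exact: ltW.
    by rewrite -expRD ler_expR; lra.
  move/sq; rewrite mulr_ge0 ?expR_ge0 ?(ltW n0)// => /(_ isT) h.
  apply: le_trans h _; rewrite mulrC -ler_pdivlMr//.
  move: hd; rewrite le_min => /andP[y1 ye].
  set y := n%:R * ln n%:R * expR (- t) in y1 ye.
  have y0 : 0 <= y by rewrite !mulr_ge0 ?expR_ge0 ?(ltW n0)//; lra.
  (* One factor [log n] of [y^2] absorbs [t] and the other is at least 1; then [y^2 <= y] since
     [d <= 1]. *)
  apply: (@le_trans _ _ (2 * y ^+ 2)); last first.
    have : 0 <= y * (1 - y) by rewrite mulr_ge0//; lra.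
    rewrite expr2; lra.
  have z0 : 0 <= (n%:R * expR (- t)) ^+ 2 by rewrite exprn_ge0 ?mulr_ge0 ?expR_ge0 ?(ltW n0).
  have -> : 2 * y ^+ 2 = 2 * ln n%:R ^+ 2 * (n%:R * expR (- t)) ^+ 2 by rewrite /y; ring.
  apply: ler_wpM2r => //; apply: le_trans tl _; rewrite ler_wpM2l//.
  by rewrite expr2 -[leLHS]mulr1 ler_wpM2l//; lra.
apply: big; apply: le_trans bn _; rewrite E5.
rewrite -[leLHS]mulrA -[leRHS]mulrA; apply: ler_wpM2l; first exact: expR_ge0.
rewrite [X in X * _ <= _]nE -!expRD.
apply: (@le_trans _ _ (expR 2 * (1 * expR (- (1 / 4 * t))))).
  by rewrite mul1r -expRD ler_expR; lra.
apply: ler_wpM2l; first exact: expR_ge0.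
apply: ler_wpM2r; first exact: expR_ge0.
by rewrite exprn_ege1.
Qed.

Let sqr_le_expn k : (k ^ 2 <= 2 * 2 ^ k)%N.
Proof.
case: k => [|[|[|k]]]//; elim: k => // k IHk.
rewrite [leqRHS](_ : _ = 2 * (2 * 2 ^ k.+3))%N; last by rewrite [in LHS]expnS.
apply: (@leq_trans (2 * k.+3 ^ 2)); last by rewrite leq_mul2l.
by rewrite !expnS expn0; nia.
Qed.

Let geometric_half r : \sum_(2 <= k < r) (1 / 2 : R) ^+ k <= 1 / 2.
Proof.
suff h m : \sum_(2 <= k < m.+2) (1 / 2 : R) ^+ k = 1 / 2 - (1 / 2) ^+ m.+1.
  case: r => [|[|r]]; [by rewrite big_geq// divr_ge0|by rewrite big_geq// divr_ge0|].
  by rewrite h gerBl exprn_ge0//; lra.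
elim: m => [|m IHm]; first by rewrite big_geq// expr1 subrr.
by rewrite big_nat_recr//= IHm !exprS; lra.
Qed.

(** Comparison with a geometric series: [b = base n p k] is at most 1/4, and [k^2 <= 2 * 2^k]
    absorbs the choice of the edge. *)
Lemma small_sides_bound_small e : 0 < e -> exists2 d, 0 < d & exists T, forall n p r,
  above_threshold d T n p -> p <= 1 / 32 -> r.-1%:R * p <= 1 ->
  \sum_(2 <= k < r) (n * 'C(n, k) * k ^ 2)%:R *
    (p ^+ 1 * (1 - p) ^+ k * (p + (1 - p) ^+ k.+1) ^+ (n - k.+1)) <= e.
Proof.
move=> e0; pose e' := Num.min (1 / 16) (e / 16).
have e'0 : 0 < e' by rewrite lt_min !divr_gt0.
have [d d0 [T hT]] := base_small e'0.
exists d => //; exists T => n p r H p1 rp1; have [p01 _ _ _] := H.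
have /andP[p0 _] := p01.
(* The constant 32 comes from [(1/4)^(k-2) * 2 * 2^k = 32 (1/2)^k]. *)
apply: (@le_trans _ _ (\sum_(2 <= k < r) (e' * 32) * (1 / 2) ^+ k)); last first.
  rewrite -mulr_sumr; have := geometric_half r.
  have : e' <= e / 16 by rewrite ge_min lexx orbT.
  set s := \sum_(_ <= _ < _) _ => he hs.
  have : 0 <= e' * (1 / 2 - s) by rewrite mulr_ge0 ?(ltW e'0)// subr_ge0.
  lra.
rewrite !big_nat; apply: ler_sum => k /andP[k2 kr].
have k_gt0 : (0 < k)%N by exact: ltnW.
have kp1 : k%:R * p <= 1.
  apply: le_trans rp1; rewrite ler_wpM2r// ler_nat; lia.
have [t1 tb] := hT _ _ _ H p1 k_gt0 kp1.
apply: le_trans (small_side_term n p01 k_gt0 kp1) _.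
set t := n%:R * p in t1 tb *; set b := base n p k in tb *.
have b0 : 0 <= b by rewrite /b /base !mulr_ge0 ?expR_ge0.
have t0 : 0 <= t by apply: le_trans t1.
have e16 : e' <= 1 / 16 by rewrite ge_min lexx.
have b4 : b <= 1 / 4.
  rewrite -(@ler_pXn2r _ 2) ?nnegrE ?divr_ge0//.
  have : 0 <= (t - 1) * b ^+ 2 by rewrite mulr_ge0 ?exprn_ge0//; lra.
  lra.
have k2' : k = (2 + (k - 2))%N by rewrite subnKC.
have bk : t * b ^+ k <= e' * (1 / 4) ^+ (k - 2).
  rewrite [in leLHS]k2' exprD mulrA; apply: ler_pM => //.
  - by rewrite mulr_ge0 ?exprn_ge0.
  - by rewrite exprn_ge0.
  by rewrite lerXn2r ?nnegrE ?divr_ge0.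
have kk : (k%:R : R) ^+ 2 <= 2 * 2 ^+ k by rewrite -!natrX -natrM ler_nat sqr_le_expn.
rewrite mulrAC; apply: le_trans (ler_pM _ _ bk kk) _; rewrite ?mulr_ge0 ?exprn_ge0//.
rewrite le_eqVlt; apply/orP; left; apply/eqP.
rewrite [in RHS]k2' [X in 2 * 2 ^+ X]k2' !exprD -!mulrA; congr (_ * _).
rewrite [RHS](_ : _ = 8 * (1 / 2) ^+ (k - 2)); last by field.
rewrite (_ : 1 / 4 = (1 / 2) * (1 / 2)); last by field.
rewrite exprMn; have : (1 / 2 : R) ^+ (k - 2) * 2 ^+ (k - 2) = 1.
  by rewrite -exprMn (_ : 1 / 2 * 2 = 1) ?expr1n//; field.
move=> h; transitivity ((1 / 2) ^+ (k - 2) * 8 * ((1 / 2 : R) ^+ (k - 2) * 2 ^+ (k - 2))).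
  by ring.
by rewrite h; ring.
Qed.

End SparseBounds.

Local Open Scope classical_set_scope.

(** * Asymptotics *)

Section Asymptotics.
Variables (R : realType) (p : nat -> R).
Hypothesis hp : forall n, 0 <= p n <= 1.
Implicit Types (P Q : forall n : nat, {set {set 'I_n}} -> Prop).

Definition negligible P := forall e : R, 0 < e ->
  \forall n \near \oo, Gnp_prob (p n) (P n) <= e.

Lemma aas_negligible P : negligible (fun n E => ~ P n E) -> aas p P.
Proof.
move=> nP; apply/cvgrPdist_le => e e0; near=> n.
rewrite Gnp_probC// opprB addrC subrK ger0_norm ?Gnp_prob_ge0//.
by near: n; exact: nP.
Unshelve. all: by end_near. Qed.

Lemma negligible_or P Q : negligible P -> negligible Q ->
  negligible (fun n E => P n E \/ Q n E).
Proof.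
move=> nP nQ e e0; near=> n.
apply: le_trans (Gnp_prob_or (hp n) _ _) _; rewrite (splitr e) lerD//.
- by near: n; apply: nP; rewrite divr_gt0.
- by near: n; apply: nQ; rewrite divr_gt0.
Unshelve. all: by end_near. Qed.

Lemma negligible_sub P Q :
    (forall n (E : {set {set 'I_n}}), P n E -> Q n E) -> negligible Q -> negligible P.
Proof.
move=> PQ nQ e e0; near=> n.
apply: (@le_trans _ _ (Gnp_prob (p n) (Q n))); last by near: n; exact: nQ.
by apply: Gnp_prob_mono => // E _; exact: PQ.
Unshelve. all: by end_near. Qed.

Lemma negligible_independent_triple :
  (fun n => n%:R * (1 - p n)) @ \oo --> (0 : R) ->
  negligible (fun n E => independent_triple E).
Proof.
move=> q0 e e0; have [d d0 hd] := triple_bound_small_codegree e0.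
near=> n; apply: le_trans (Gnp_independent_triple n (hp n)) _.
apply: hd => //; apply: le_trans (ler_norm _) _; rewrite -normrN -sub0r.
by near: n; move/cvgrPdist_le: q0; exact.
Unshelve. all: by end_near. Qed.

Hypothesis hi : exists omega : nat -> R,
  omega @ \oo --> +oo /\
  \forall n \near \oo,
    (ln (n%:R) + ln (ln (n%:R)) + omega n) / n%:R < p n.

(** Hypothesis (i) bounds the threshold quantity by [e^(- omega n)]. *)
Lemma near_above_threshold (d T : R) : 0 < d ->
  \forall n \near \oo, above_threshold d T n (p n).
Proof.
move=> d0; have [w [w_oo wp]] := hi; near=> n.
have n_large : expR (Num.max 1 T) <= n%:R by near: n; exact: nbhs_infty_ger.
have n0 : 0 < (n%:R : R) by apply: lt_le_trans n_large; exact: expR_gt0.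
have : Num.max 1 T <= ln (n%:R : R) by rewrite -ler_expR lnK.
rewrite ge_max => /andP[l1 lT].
have l0 : 0 < ln (n%:R : R) by apply: lt_le_trans l1.
have ll0 : 0 <= ln (ln (n%:R : R)) by exact: ln_ge0.
have w_large : Num.max 0 (- ln d) <= w n.
  by near: n; move/cvgryPge : w_oo; exact.
move: w_large; rewrite ge_max => /andP[w0 wd].
have np : ln n%:R + ln (ln n%:R) + w n < n%:R * p n.
  by rewrite mulrC -ltr_pdivrMr//; near: n; exact: wp.
split => //; first by lra.
rewrite -[X in X * _ * _](@lnK _ n%:R)// -[X in _ * X * _](@lnK _ (ln n%:R))//.
rewrite -!expRD -[leRHS](@lnK _ d)// ler_expR; lra.
Unshelve. all: by end_near. Qed.

Lemma negligible_two_large_comps : negligible (fun n E => two_large_comps E).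
Proof.
move=> e e0; have e20 : 0 < e / 2 by rewrite divr_gt0.
have [d d0 [T1 h1]] := small_sides_bound_small e20.
have [T2 h2] := sparse_sides_bound_small e20.
have [N h3] := dense_sides_bound_small e0.
near=> n; have /andP[p0 p1] := hp n.
have H : above_threshold d (Num.max 1 (Num.max T1 T2)) n (p n).
  by near: n; exact: near_above_threshold.
have [p_large|p_small] := lerP (1 / 32) (p n).
  apply: (@le_trans _ _ (Gnp_prob (p n) (@two_sides n 2))).
    (* With [r = 2] no small side is possible, as no [k] satisfies [1 < k < 2]. *)
    apply: Gnp_prob_mono => // E _ /(two_large_comps_sides 2)[[k /andP[k1 k2]]|//].
    by move: k1; rewrite ltnNge -ltnS k2.
  apply: le_trans (@Gnp_two_sides_dense R n (p n) (hp n) 2 isT) _.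
  apply: h3; first by rewrite p_large.
  by near: n; exact: nbhs_infty_ger.
move: H => [_]; rewrite !ge_max => /and3P[_ l1 l2] /and3P[t1 tT1 tT2] hd.
have p_gt0 : 0 < p n.
  by rewrite lt_neqAle p0 andbT; apply: contraTneq t1 => <-; rewrite mulr0 -ltNge.
(* The integer part plus one, so that [(r - 1) p <= 1 <= r p <= 2]: small sides keep [k p <= 1], and
   large ones have [r p >= 1]. *)
pose r := (Num.truncn (1 / p n)).+1.
have rp : r.-1%:R * p n <= 1.
  by rewrite -ler_pdivlMr//= Num.Theory.truncn_le// divr_ge0// ltW.
have rp1 : 1 <= r%:R * p n.
  by rewrite -ler_pdivrMr// ltW// Num.Theory.truncnS_gt.
have rp2 : r%:R * p n <= 2.
  have -> : r%:R = r.-1%:R + 1 :> R by rewrite natr1.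
  by rewrite mulrDl mul1r; lra.
apply: (@le_trans _ _ (Gnp_prob (p n)
  (fun E => (exists2 k, (1 < k < r)%N & small_side k E) \/ @two_sides n r E))).
  by apply: Gnp_prob_mono => // E _; exact: two_large_comps_sides.
apply: le_trans (Gnp_prob_or (hp n) _ _) _; rewrite (splitr e) lerD//; last first.
  apply: le_trans (Gnp_two_sides n (hp n) r) _; apply: h2 => //; lra.
apply: le_trans (h1 n (p n) r _ _ rp); last 2 first.
- by split.
- by lra.
rewrite big_geq_mkord.
apply: le_trans (@Gnp_prob_le_sum _ n _ (hp n) _ (fun k : 'I_r => (1 < k)%N)
  (fun k => small_side k) _ _) _.
  by move=> E _ [k /andP[k1 kr] hk]; exists (Ordinal kr).
by apply: ler_sum => k _; exact: Gnp_small_side.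
Unshelve. all: by end_near. Qed.

Lemma negligible_star_cut_vertex :
  (fun n => n%:R * (1 - p n)) @ \oo --> (0 : R) \/
  (fun n => n%:R * (1 - p n)) @ \oo --> +oo ->
  negligible (fun n E => exists a : 'I_n, star_cut_vertex E a).
Proof.
case=> [q0|q_oo].
  apply: negligible_sub (negligible_or negligible_two_large_comps
    (negligible_independent_triple q0)) => n E [a].
  exact: star_cut_vertex_triple.
(* The sequence [p] may cross 1/32 infinitely often, so the configuration to exclude is selected
   separately for each [n]. *)
pose Q n (E : {set {set 'I_n}}) := if p n < 1 / 32
  then (has_degree 0 E \/ has_degree 1 E) \/ two_common_neighbours E
  else independent_triple E.
apply: (@negligible_sub _ (fun n E => two_large_comps E \/ Q n E)).
  move=> n E [a aE]; rewrite /Q; case: ifP => _; last exact: star_cut_vertex_triple aE.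
  case: (star_cut_vertex_configurations aE) => ?; by
    [left|right; left; left|right; left; right|right; right].
apply: negligible_or; first exact: negligible_two_large_comps.
move=> e e0; have e20 : 0 < e / 2 by rewrite divr_gt0.
have [d d0 [T1 h1]] := degree_bound_small e20.
have [T2 h2] := common_neighbours_bound_small e20.
have [T3 h3] := triple_bound_small e0.
near=> n; have /andP[p0 p1] := hp n; rewrite /Q.
have H : above_threshold d (Num.max T1 T2) n (p n).
  by near: n; exact: near_above_threshold.
have [p_small|p_large] := ltrP (p n) (1 / 32); last first.
  apply: le_trans (Gnp_independent_triple n (hp n)) _.
  apply: h3; first by rewrite p_large.
  by near: n; move/cvgryPge : q_oo; exact.
move: H => [_]; rewrite !ge_max => /andP[l1 l2] /andP[t1 t2] hd.
apply: le_trans (Gnp_prob_or (hp n) _ _) _; rewrite (splitr e) lerD//; last first.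
  apply: le_trans (Gnp_two_common_neighbours n (hp n)) _.
  by apply: h2 => //; rewrite p0 ltW.
apply: le_trans (Gnp_prob_or (hp n) _ _) _.
apply: le_trans (h1 n (p n) _); last by split.
by apply: lerD; exact: Gnp_has_degree.
Unshelve. all: by end_near. Qed.

End Asymptotics.

Unset Implicit Arguments.

Theorem theorem1p5 (R : realType) (p : nat -> R)
  (hp : forall n, 0 <= p n <= 1)
  (hi : exists omega : nat -> R,
      omega @ \oo --> +oo /\
      \forall n \near \oo,
        (ln (n%:R) + ln (ln (n%:R)) + omega n) / n%:R < p n) :
  ((fun n => n%:R * (1 - p n)) @ \oo --> (0 : R) \/
   (fun n => n%:R * (1 - p n)) @ \oo --> +oo ->
   aas p (fun n E => forall a : 'I_n, ~ star_cut_vertex E a))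
  /\
  aas p (fun n E => forall a : 'I_n, star_cut_vertex E a ->
           forall x y, x \in ~: star E a -> y \in ~: star E a ->
             (1 < #|comp_in E (~: star E a) x|)%N ->
             (1 < #|comp_in E (~: star E a) y|)%N ->
             comp_in E (~: star E a) x = comp_in E (~: star E a) y).
Proof.
split=> [hq|]; apply: aas_negligible => //.
  apply: (negligible_sub hp) (negligible_star_cut_vertex hp hi hq) => n E.
  by move=> /existsNP[a /contrapT aE]; exists a.
apply: (negligible_sub hp) (negligible_two_large_comps hp hi) => n E hE.
apply: contrapT => nlarge; apply: hE => a _ x y xS yS cx cy.
by apply/eqP/negPn/negP => xy; apply: nlarge; exists a, x, y.
Qed.
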